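(* Let $\mathscr{C}$ be an $\infty$-category which admits finite limits. Then an object $x \in \mathscr{C}$ is $h$-initial if and only if it is initial.
   Context: An $\infty$-category is a quasi-category. Finite limits are limits indexed by finite simplicial sets. An object $x\in\mathscr{C}$ is initial if $\mathscr{C}_{x/}\to\mathscr{C}$ is a trivial fibration, equivalently if $\mathrm{map}_{\mathscr{C}}(x,y)$ is contractible for all $y\in\mathscr{C}$. An object $x\in\mathscr{C}$ is $h$-initial if it defines an initial object of the homotopy category $\mathrm{h}\mathscr{C}$, equivalently if $\mathrm{map}_{\mathscr{C}}(x,y)$ is non-empty and connected for all $y\in\mathscr{C}$. *)

(* Defs.v *)
From HB Require Import structures.
From mathcomp Require Import all_boot all_order.
From mathcomp Require Import generic_quotient.
From mathcomp Require Import boolp classical_sets cardinality.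

Set Implicit Arguments.
Unset Strict Implicit.
Unset Printing Implicit Defensive.

Import Order.TTheory.

Lemma sval_inj (T : Type) (P : T -> Prop) (u v : {x | P x}) :
  sval u = sval v -> u = v.
Proof. by case: u v => [x Px] [y Py] /= xy; apply: eq_exist. Qed.

(* Morphisms [m] -> [n] of the simplex category, [n] being 'I_n.+1 *)
Notation ordmap m n := {omorphism 'I_m.+1 -> 'I_n.+1}.

Lemma ordmapP m n (f g : ordmap m n) : f =1 g -> f = g.
Proof.
case: f g => [f [[Hf]]] [g [[Hg]]] /= /funext fg.
by move: Hf Hg; rewrite fg => Hf Hg; rewrite (Prop_irrelevance Hf Hg).
Qed.

Definition ord_id n : ordmap n n := idfun.
Definition ord_comp l m n (f : ordmap m n) (g : ordmap l m) : ordmap l n :=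
  f \o g.

Definition const_fun m n (k : 'I_n.+1) of 'I_m.+1 : 'I_n.+1 := k.
Lemma const_subproof m n (k : 'I_n.+1) :
  Order.nondecreasing (@const_fun m n k).
Proof. by []. Qed.
HB.instance Definition _ m n (k : 'I_n.+1) :=
  Order.isOrderMorphism.Build _ 'I_m.+1 _ 'I_n.+1 _ (@const_subproof m n k).
Definition ord_const m n (k : 'I_n.+1) : ordmap m n := @const_fun m n k.

Lemma coface_subproof n (i : 'I_n.+2) :
  Order.nondecreasing (lift i : 'I_n.+1 -> 'I_n.+2).
Proof. by move=> j k; rewrite !leEord /= leq_bump2. Qed.
HB.instance Definition _ n (i : 'I_n.+2) :=
  Order.isOrderMorphism.Build _ 'I_n.+1 _ 'I_n.+2 _ (@coface_subproof n i).
Definition coface n (i : 'I_n.+2) : ordmap n n.+1 := lift i : 'I_n.+1 -> _.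

Definition codegen_fun n (i : 'I_n.+1) (j : 'I_n.+2) : 'I_n.+1 :=
  inord (unbump i j).
Lemma codegen_val n (i : 'I_n.+1) (j : 'I_n.+2) :
  codegen_fun i j = unbump i j :> nat.
Proof.
rewrite /codegen_fun inordK // /unbump ltnS.
have := ltn_ord i; have := ltn_ord j; rewrite !ltnS => jn ln.
case: ltnP => [ij|ji]; last by rewrite subn0 (leq_trans ji).
by rewrite leq_subLR add1n.
Qed.
Lemma codegen_subproof n (i : 'I_n.+1) :
  Order.nondecreasing (codegen_fun i).
Proof.
move=> j k; rewrite !leEord !codegen_val /unbump => jk.
case: (ltnP i j) => [ij|ji]; first by rewrite (leq_trans ij jk) leq_sub2r.
rewrite subn0; case: ltnP => [ik|_]; last by rewrite subn0.
by rewrite subn1 (leq_trans ji) // -ltnS (ltn_predK ik).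
Qed.
HB.instance Definition _ n (i : 'I_n.+1) :=
  Order.isOrderMorphism.Build _ 'I_n.+2 _ 'I_n.+1 _ (@codegen_subproof n i).
Definition codegen n (i : 'I_n.+1) : ordmap n.+1 n := codegen_fun i.

Record sSet := SSet {
  simplex :> nat -> Type;
  act : forall m n, ordmap m n -> simplex n -> simplex m;
  act_id : forall n (x : simplex n), act (ord_id n) x = x;
  act_comp : forall l m n (f : ordmap m n) (g : ordmap l m) (x : simplex n),
    act (ord_comp f g) x = act g (act f x) }.

Record sMap (X Y : sSet) := SMap {
  smap :> forall n, X n -> Y n;
  smap_act : forall m n (f : ordmap m n) (x : X n),
    smap (act f x) = act f (smap x) }.
Arguments smap {X Y} _ {n} _.

Lemma sMapP (X Y : sSet) (f g : sMap X Y) :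
  (forall n (x : X n), f n x = g n x) -> f = g.
Proof.
case: f g => [f Hf] [g Hg] /= fg.
have {}fg : f = g by apply/functional_extensionality_dep => n; apply/funext.
by move: Hf Hg; rewrite fg => Hf Hg; rewrite (Prop_irrelevance Hf Hg).
Qed.

Definition smap_id (X : sSet) : sMap X X :=
  @SMap X X (fun _ x => x) (fun _ _ _ _ => erefl).

Lemma smap_comp_subproof (X Y Z : sSet) (g : sMap Y Z) (f : sMap X Y)
  m n (t : ordmap m n) (x : X n) : g m (f m (act t x)) = act t (g n (f n x)).
Proof. by rewrite !smap_act. Qed.
Definition smap_comp (X Y Z : sSet) (g : sMap Y Z) (f : sMap X Y) : sMap X Z :=
  SMap (smap_comp_subproof g f).

Record subsset (X : sSet) := SubSSet {
  smem : forall n, X n -> Prop;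
  smem_act : forall m n (f : ordmap m n) (x : X n), smem x -> smem (act f x) }.
Arguments smem {X} _ {n} _.

Definition sub_act (X : sSet) (A : subsset X) m n (f : ordmap m n)
    (x : {x : X n | smem A x}) : {x : X m | smem A x} :=
  exist _ (act f (sval x)) (smem_act f (svalP x)).

Lemma sub_act_id (X : sSet) (A : subsset X) n (x : {x : X n | smem A x}) :
  sub_act (ord_id n) x = x.
Proof. by apply: sval_inj; rewrite /= act_id. Qed.

Lemma sub_act_comp (X : sSet) (A : subsset X) l m n (f : ordmap m n)
    (g : ordmap l m) (x : {x : X n | smem A x}) :
  sub_act (ord_comp f g) x = sub_act g (sub_act f x).
Proof. by apply: sval_inj; rewrite /= act_comp. Qed.

Definition sset_of_sub (X : sSet) (A : subsset X) : sSet :=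
  SSet (@sub_act_id X A) (@sub_act_comp X A).
Coercion sset_of_sub : subsset >-> sSet.

Definition sub_incl (X : sSet) (A : subsset X) : sMap A X :=
  @SMap A X (fun _ x => sval x) (fun _ _ _ _ => erefl).

Lemma Delta_act_id n m (t : ordmap m n) : ord_comp t (ord_id m) = t.
Proof. exact: ordmapP. Qed.

Lemma Delta_act_comp n l m k (f : ordmap m k) (g : ordmap l m)
    (t : ordmap k n) : ord_comp t (ord_comp f g) = ord_comp (ord_comp t f) g.
Proof. exact: ordmapP. Qed.

Definition Delta (n : nat) : sSet :=
  @SSet (fun m => ordmap m n) (fun _ _ f t => ord_comp t f)
    (@Delta_act_id n) (@Delta_act_comp n).

(* The map Delta n -> X classifying an n-simplex (Yoneda) *)
Lemma yo_subproof (X : sSet) n (x : X n) k m (f : ordmap k m)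
    (t : Delta n m) : act (act f t : ordmap k n) x = act f (act t x).
Proof. exact: act_comp. Qed.
Definition yo (X : sSet) n (x : X n) : sMap (Delta n) X :=
  @SMap (Delta n) X (fun m t => act t x) (yo_subproof x).

Definition boundary_mem n m (t : Delta n m) : Prop :=
  exists j : 'I_n.+1, forall i, t i != j.
Lemma boundary_subproof n k m (f : ordmap k m) (t : Delta n m) :
  boundary_mem t -> boundary_mem (act f t).
Proof. by case=> j jt; exists j => i; apply: jt. Qed.
Definition boundary n : subsset (Delta n) :=
  SubSSet (@boundary_subproof n).

Definition horn_mem n (k : 'I_n.+1) m (t : Delta n m) : Prop :=
  exists2 j : 'I_n.+1, j != k & forall i, t i != j.
Lemma horn_subproof n (k : 'I_n.+1) l m (f : ordmap l m) (t : Delta n m) :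
  horn_mem k t -> horn_mem k (act f t).
Proof. by case=> j jk jt; exists j => // i; apply: jt. Qed.
Definition horn n (k : 'I_n.+1) : subsset (Delta n) :=
  SubSSet (@horn_subproof n k).

Definition quasicategory (C : sSet) : Prop :=
  forall n (k : 'I_n.+1), 0 < k < n ->
  forall u : sMap (horn k) C, exists v : sMap (Delta n) C,
  smap_comp v (sub_incl (horn k)) = u.

Definition trivial_fibration (X Y : sSet) (p : sMap X Y) : Prop :=
  forall n (u : sMap (boundary n) X) (v : sMap (Delta n) Y),
  smap_comp p u = smap_comp v (sub_incl (boundary n)) ->
  exists w : sMap (Delta n) X,
    smap_comp w (sub_incl (boundary n)) = u /\ smap_comp p w = v.

Definition degenerate (X : sSet) (s : {n & X n}) : Prop :=
  exists n (i : 'I_n.+1) (y : X n),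
    s = existT (fun n => X n) n.+1 (act (codegen i) y).

Definition finite_sset (X : sSet) : Prop :=
  finite_set [set s : {n & X n} | ~ degenerate s].

(* For a simplex p : [n] -> [1] of Delta 1, the simplicial subset of Delta n
   spanned by the vertices i with p i = e; it is empty or a simplex. *)
Definition fiber_mem n (p : ordmap n 1) (e : 'I_2) m (t : Delta n m) : Prop :=
  forall i, p (t i) = e.
Lemma fiber_subproof n (p : ordmap n 1) e k m (f : ordmap k m)
    (t : Delta n m) : fiber_mem p e t -> fiber_mem p e (act f t).
Proof. by move=> pt i; apply: pt. Qed.
Definition fiber n (p : ordmap n 1) (e : 'I_2) : subsset (Delta n) :=
  SubSSet (@fiber_subproof n p e).

Definition fiber_map m n (f : ordmap m n) (p : ordmap n 1) e :
    sMap (fiber (ord_comp p f) e) (fiber p e).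
Proof.
exists (fun k (t : fiber (ord_comp p f) e k) =>
  exist (fiber_mem p e (m := k)) (ord_comp f (sval t)) (svalP t)).
by move=> k l g t; apply: sval_inj; apply: ordmapP.
Defined.

(* An n-simplex of the join X * Y is a simplex p : [n] -> [1] together with
   maps p^-1(0) -> X and p^-1(1) -> Y; when both fibers are nonempty this is a
   pair of an i-simplex of X and a j-simplex of Y with i + j + 1 = n. *)
Record join_simplex (X Y : sSet) (n : nat) := JoinSimplex {
  jcut : ordmap n 1;
  jleft : sMap (fiber jcut ord0) X;
  jright : sMap (fiber jcut ord_max) Y }.

Lemma join_simplexP (X Y : sSet) n (a b : join_simplex X Y n) :
  jcut a =1 jcut b ->
  (forall m (t : ordmap m n) ha hb,
    jleft a m (exist _ t ha) = jleft b m (exist _ t hb)) ->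
  (forall m (t : ordmap m n) ha hb,
    jright a m (exist _ t ha) = jright b m (exist _ t hb)) ->
  a = b.
Proof.
case: a b => [p l r] [q l' r'] /= /ordmapP pq; case: _ / pq l' r' => l' r' Hl Hr.
by congr JoinSimplex; apply: sMapP => m [t ht].
Qed.

Definition join_act (X Y : sSet) m n (f : ordmap m n)
    (s : join_simplex X Y n) : join_simplex X Y m :=
  JoinSimplex (smap_comp (jleft s) (fiber_map f (jcut s) ord0))
              (smap_comp (jright s) (fiber_map f (jcut s) ord_max)).

Lemma join_act_id (X Y : sSet) n (s : join_simplex X Y n) :
  join_act (ord_id n) s = s.
Proof.
apply: join_simplexP => [//|m t ha hb|m t ha hb] /=;
  by congr smap; apply: sval_inj; apply: ordmapP.
Qed.

Lemma join_act_comp (X Y : sSet) l m n (f : ordmap m n) (g : ordmap l m)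
    (s : join_simplex X Y n) :
  join_act (ord_comp f g) s = join_act g (join_act f s).
Proof.
apply: join_simplexP => [//|k t ha hb|k t ha hb] /=;
  by congr smap; apply: sval_inj; apply: ordmapP.
Qed.

Definition join (X Y : sSet) : sSet :=
  SSet (@join_act_id X Y) (@join_act_comp X Y).

Definition join_map (X X' Y Y' : sSet) (f : sMap X X') (g : sMap Y Y') :
    sMap (join X Y) (join X' Y').
Proof.
exists (fun n (s : join X Y n) =>
  JoinSimplex (smap_comp f (jleft s)) (smap_comp g (jright s))).
by move=> m n t s; apply: join_simplexP => // k u ha hb /=;
  congr (smap _ (smap _ _)); apply: sval_inj.
Defined.

Lemma ord2_neq01 : ord0 != ord_max :> 'I_2. Proof. by []. Qed.
Lemma ord2_neq10 : ord_max != ord0 :> 'I_2. Proof. by []. Qed.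

Lemma fiber_const_empty n (e e' : 'I_2) m :
  e != e' -> fiber (ord_const n e) e' m -> False.
Proof. by move=> /eqP ne [t te]; apply: ne; apply: (te ord0). Qed.

Definition empty_map n (e e' : 'I_2) (ne : e != e') (Y : sSet) :
    sMap (fiber (ord_const n e) e') Y.
Proof.
exists (fun m t => False_rect _ (fiber_const_empty ne t)).
by move=> m k f t; case: (fiber_const_empty ne t).
Defined.

Definition join_inl (X Y : sSet) : sMap X (join X Y).
Proof.
exists (fun n (x : X n) => @JoinSimplex X Y n (ord_const n ord0)
  (smap_comp (yo x) (sub_incl _)) (empty_map n ord2_neq01 Y)).
move=> m n f x; apply: join_simplexP => // k t ha hb /=.
- by rewrite -act_comp.
- by case: (fiber_const_empty ord2_neq01 (exist _ t ha)).
Defined.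

Definition join_inr (X Y : sSet) : sMap Y (join X Y).
Proof.
exists (fun n (y : Y n) => @JoinSimplex X Y n (ord_const n ord_max)
  (empty_map n ord2_neq10 X) (smap_comp (yo y) (sub_incl _))).
move=> m n f y; apply: join_simplexP => // k t ha hb /=.
- by case: (fiber_const_empty ord2_neq10 (exist _ t ha)).
- by rewrite -act_comp.
Defined.

(* The map Delta m -> Delta n induced by f *)
Notation Delta_map f := (@yo (Delta _) _ f).

(* n-simplices of C_{p/}: maps K * Delta n -> C extending p *)
Definition under_simplex (K C : sSet) (p : sMap K C) (n : nat) :=
  {f : sMap (join K (Delta n)) C | smap_comp f (join_inl K (Delta n)) = p}.

Lemma under_act_subproof (K C : sSet) (p : sMap K C) m n (f : ordmap m n)
    (s : under_simplex p n) :
  smap_comp (smap_comp (sval s) (join_map (smap_id K) (Delta_map f)))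
    (join_inl K (Delta m)) = p.
Proof.
rewrite -[RHS](svalP s); apply: sMapP => k x /=; congr smap.
apply: join_simplexP => // l t ha hb /=.
by case: (fiber_const_empty ord2_neq01 (exist _ t ha)).
Qed.

Definition under_act (K C : sSet) (p : sMap K C) m n (f : ordmap m n)
    (s : under_simplex p n) : under_simplex p m :=
  exist _ _ (under_act_subproof f s).

Lemma under_act_id (K C : sSet) (p : sMap K C) n (s : under_simplex p n) :
  under_act (ord_id n) s = s.
Proof.
apply: sval_inj; apply: sMapP => k x /=; congr smap.
apply: join_simplexP => // l t ha hb /=; first by congr smap; apply: sval_inj.
rewrite (Prop_irrelevance ha hb); exact: ordmapP.
Qed.

Lemma under_act_comp (K C : sSet) (p : sMap K C) l m n (f : ordmap m n)
    (g : ordmap l m) (s : under_simplex p n) :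
  under_act (ord_comp f g) s = under_act g (under_act f s).
Proof.
apply: sval_inj; apply: sMapP => k x /=; congr smap.
apply: join_simplexP => // j t ha hb /=; first by congr smap; apply: sval_inj.
rewrite (Prop_irrelevance ha hb); exact: ordmapP.
Qed.

Definition under (K C : sSet) (p : sMap K C) : sSet :=
  SSet (@under_act_id K C p) (@under_act_comp K C p).

(* n-simplices of C_{/p}: maps Delta n * K -> C extending p *)
Definition over_simplex (K C : sSet) (p : sMap K C) (n : nat) :=
  {f : sMap (join (Delta n) K) C | smap_comp f (join_inr (Delta n) K) = p}.

Lemma over_act_subproof (K C : sSet) (p : sMap K C) m n (f : ordmap m n)
    (s : over_simplex p n) :
  smap_comp (smap_comp (sval s) (join_map (Delta_map f) (smap_id K)))
    (join_inr (Delta m) K) = p.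
Proof.
rewrite -[RHS](svalP s); apply: sMapP => k x /=; congr smap.
apply: join_simplexP => // l t ha hb /=.
by case: (fiber_const_empty ord2_neq10 (exist _ t ha)).
Qed.

Definition over_act (K C : sSet) (p : sMap K C) m n (f : ordmap m n)
    (s : over_simplex p n) : over_simplex p m :=
  exist _ _ (over_act_subproof f s).

Lemma over_act_id (K C : sSet) (p : sMap K C) n (s : over_simplex p n) :
  over_act (ord_id n) s = s.
Proof.
apply: sval_inj; apply: sMapP => k x /=; congr smap.
apply: join_simplexP => // l t ha hb /=; last by congr smap; apply: sval_inj.
rewrite (Prop_irrelevance ha hb); exact: ordmapP.
Qed.

Lemma over_act_comp (K C : sSet) (p : sMap K C) l m n (f : ordmap m n)
    (g : ordmap l m) (s : over_simplex p n) :
  over_act (ord_comp f g) s = over_act g (over_act f s).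
Proof.
apply: sval_inj; apply: sMapP => k x /=; congr smap.
apply: join_simplexP => // j t ha hb /=; last by congr smap; apply: sval_inj.
rewrite (Prop_irrelevance ha hb); exact: ordmapP.
Qed.

Definition over (K C : sSet) (p : sMap K C) : sSet :=
  SSet (@over_act_id K C p) (@over_act_comp K C p).

(* Restriction along Delta n -> K * Delta n, then Yoneda *)
Definition under_proj (K C : sSet) (p : sMap K C) : sMap (under p) C.
Proof.
exists (fun n (s : under p n) =>
  sval s n (join_inr K (Delta n) n (ord_id n))).
move=> m n f s; rewrite -smap_act /=; congr smap.
apply: join_simplexP => // k t ha hb /=; last exact: ordmapP.
by case: (fiber_const_empty ord2_neq10 (exist _ t ha)).
Defined.

Definition over_proj (K C : sSet) (p : sMap K C) : sMap (over p) C.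
Proof.
exists (fun n (s : over p n) =>
  sval s n (join_inl (Delta n) K n (ord_id n))).
move=> m n f s; rewrite -smap_act /=; congr smap.
apply: join_simplexP => // k t ha hb /=; first exact: ordmapP.
by case: (fiber_const_empty ord2_neq01 (exist _ t ha)).
Defined.

Definition initial (C : sSet) (x : C 0) : Prop :=
  trivial_fibration (under_proj (yo x)).

Definition terminal (C : sSet) (x : C 0) : Prop :=
  trivial_fibration (over_proj (yo x)).

(* l is a limit cone over p: a vertex of C_{/p}, whose apex is over_proj p l *)
Definition has_limit (K C : sSet) (p : sMap K C) : Prop :=
  exists l : over p 0, terminal l.

Definition admits_finite_limits (C : sSet) : Prop :=
  forall K : sSet, finite_sset K -> forall p : sMap K C, has_limit p.

Record category := Category {
  obj :> Type;
  hom : obj -> obj -> Type;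
  idm : forall x, hom x x;
  compm : forall x y z, hom y z -> hom x y -> hom x z;
  compm1 : forall x y (f : hom x y), compm f (idm x) = f;
  comp1m : forall x y (f : hom x y), compm (idm y) f = f;
  compmA : forall x y z w (h : hom z w) (g : hom y z) (f : hom x y),
    compm h (compm g f) = compm (compm h g) f }.

Definition initial_object (D : category) (x : D) : Prop :=
  forall y : D, exists! f : hom x y, True.

Section HomotopyCategory.
Variable X : sSet.
Local Open Scope quotient_scope.

Definition edge (x y : X 0) : Type :=
  {e : X 1 | act (coface ord_max) e = x /\ act (coface ord0) e = y}.

Inductive epath : X 0 -> X 0 -> Type :=
| enil x : epath x x
| econs x y z : edge x y -> epath y z -> epath x z.

Fixpoint ecat x y z (p : epath x y) : epath y z -> epath x z :=
  match p with
  | enil _ => fun q => q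
  | econs _ _ _ e p => fun q => econs e (ecat p q)
  end.

Definition epath1 x y (e : edge x y) : epath x y := econs e (enil y).

(* The congruence on the free category on the edges of X generated by
   s_0 x ~ id_x and d_1 s ~ (d_0 s) o (d_2 s), for x in X_0 and s in X_2. *)
Inductive econg : forall x y, epath x y -> epath x y -> Prop :=
| econg_refl x y (p : epath x y) : econg p p
| econg_sym x y (p q : epath x y) : econg p q -> econg q p
| econg_trans x y (p q r : epath x y) : econg p q -> econg q r -> econg p r
| econg_cat x y z (p p' : epath x y) (q q' : epath y z) :
    econg p p' -> econg q q' -> econg (ecat p q) (ecat p' q')
| econg_degen x (e : edge x x) :
    sval e = act (codegen ord0) x -> econg (epath1 e) (enil x)
| econg_triangle x y z (f : edge x y) (g : edge y z) (h : edge x z) (s : X 2) :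
    act (coface ord_max) s = sval f -> act (coface ord0) s = sval g ->
    act (coface (lift ord0 ord0)) s = sval h ->
    econg (epath1 h) (ecat (epath1 f) (epath1 g)).

Lemma ecat_nil x y (p : epath x y) : ecat p (enil y) = p.
Proof. by elim: p => //= x' y' z' e p ->. Qed.

Lemma ecatA x y z w (p : epath x y) (q : epath y z) (r : epath z w) :
  ecat p (ecat q r) = ecat (ecat p q) r.
Proof. by elim: p q => //= x' y' z' e p IH q; rewrite IH. Qed.

Definition econgb x y : rel {classic epath x y} := fun p q => `[< econg p q >].

Lemma econgb_refl x y : reflexive (@econgb x y).
Proof. by move=> p; apply/asboolP; apply: econg_refl. Qed.
Lemma econgb_sym x y : symmetric (@econgb x y).
Proof. by move=> p q; apply/asboolP/asboolP; apply: econg_sym. Qed.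
Lemma econgb_trans x y : transitive (@econgb x y).
Proof.
by move=> q p r /asboolP pq /asboolP qr; apply/asboolP; apply: econg_trans qr.
Qed.
Canonical econg_equiv x y :=
  EquivRel (@econgb x y) (@econgb_refl x y) (@econgb_sym x y)
    (@econgb_trans x y).

Definition ho_hom (x y : X 0) : Type := {eq_quot econg_equiv x y}.
Definition ho_class x y (p : epath x y) : ho_hom x y :=
  \pi_{eq_quot econg_equiv x y} (p : {classic epath x y}).
Definition ho_repr x y (f : ho_hom x y) : epath x y :=
  repr (f : {eq_quot econg_equiv x y}).

Lemma ho_reprK x y (f : ho_hom x y) : ho_class (ho_repr f) = f.
Proof. exact: reprK. Qed.

Lemma ho_classP x y (p q : epath x y) :
  ho_class p = ho_class q <-> econg p q.
Proof.
split=> [/eqmodP/asboolP //|pq].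
by apply/eqmodP/asboolP.
Qed.

Lemma ho_reprP x y (p : epath x y) : econg (ho_repr (ho_class p)) p.
Proof. by apply/ho_classP; rewrite ho_reprK. Qed.

Definition ho_id x : ho_hom x x := ho_class (enil x).
Definition ho_comp x y z (g : ho_hom y z) (f : ho_hom x y) : ho_hom x z :=
  ho_class (ecat (ho_repr f) (ho_repr g)).

Lemma ho_compE x y z (p : epath x y) (q : epath y z) :
  ho_comp (ho_class q) (ho_class p) = ho_class (ecat p q).
Proof. by apply/ho_classP/econg_cat; apply: ho_reprP. Qed.

Lemma ho_comp1 x y (f : ho_hom x y) : ho_comp f (ho_id x) = f.
Proof. by rewrite -(ho_reprK f) ho_compE. Qed.

Lemma ho_1comp x y (f : ho_hom x y) : ho_comp (ho_id y) f = f.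
Proof. by rewrite -(ho_reprK f) ho_compE ecat_nil. Qed.

Lemma ho_compA x y z w (h : ho_hom z w) (g : ho_hom y z) (f : ho_hom x y) :
  ho_comp h (ho_comp g f) = ho_comp (ho_comp h g) f.
Proof.
by rewrite -(ho_reprK f) -(ho_reprK g) -(ho_reprK h) !ho_compE ecatA.
Qed.

(* The left adjoint of the nerve applied to X *)
Definition ho : category := Category ho_comp1 ho_1comp ho_compA.

End HomotopyCategory.

Definition h_initial (C : sSet) (x : C 0) : Prop :=
  @initial_object (ho C) x.

(* Main.v *)
Require Import Defs.
From HB Require Import structures.
From mathcomp Require Import all_boot all_order.
From mathcomp Require Import zify.
From mathcomp Require Import boolp.
From mathcomp Require classical_sets cardinality.

Set Implicit Arguments.
Unset Strict Implicit.
Unset Printing Implicit Defensive.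

Import Order.TTheory.

(** An object [x] is initial iff every map from the boundary of [Delta n.+1]
    to [C] that sends the vertex [0] to [x] extends to [Delta n.+1]
    ([fills_boundaries]); this is the lifting property of [C_{x/} -> C] read
    through the isomorphism of [Delta 0 * Delta n] with [Delta n.+1]
    ([initial_fills], [fills_initial]).  Filling boundaries in dimensions 1 and
    2 makes [x] initial in the homotopy category ([fills_h_initial]).

    Conversely let [x] be h-initial and let [u] be a map from the boundary of
    [Delta n.+1] to [C] with [u 0 = x].  The boundary is a finite simplicial
    set, so there is a cone over [u], with apex [L] say; that it can be chosen
    to be a limit cone plays no role.  Let [r : L -> x] be its leg at the
    vertex [0].  Since [x] is h-initial there is an edge [s : x -> L], and the
    composite of [s] and [r] is homotopic to the identity, so some triangle
    [sigma] has edges [s], [r] and the identity of [x]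
    ([h_initial_section]).

    Now regard [sigma], the cone and [u] as a map defined on part of
    [Delta n.+3], whose vertices are [0] (the source of [s]), [1] (the apex
    [L]), [2] (the vertex [0] of [u]) and [3, ..., n.+3] (the remaining
    vertices of [u]); on the faces that omit [1] and some vertex [>= 3] it is
    given by [u], the vertices [0] and [2] both being mapped to [u 0].  Inner
    horns at the vertex [2] extend it to all faces that omit some vertex
    [>= 3], and then one inner horn at the vertex [1] extends it to the face on
    [0, 3, ..., n.+3], which is the required filler of [u]
    ([boundary_filler]).  In effect the section of [r] is lifted along a right
    fibration, so no filling of outer horns is needed.

    Both extensions are instances of one statement ([extend_toggle]): if the
    faces to be added come in pairs [S], [S :\ c] with [c] an inner vertex of
    [S], then all of them can be added by filling inner horns. *)

(** * Monotone maps and partial maps on a simplex *)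

(** [lia] after abstracting the natural numbers underlying ordinals, so that
    convertible but distinct ways of writing the same ordinal do not matter. *)
Ltac ord_lia :=
  repeat (match goal with |- context [nat_of_ord ?x] =>
    let a := fresh "a" in set (a := nat_of_ord x) in *; clearbody a end);
  cbv beta; lia.

Lemma ord_compE l m n (f : ordmap m n) (g : ordmap l m) i :
  ord_comp f g i = f (g i).
Proof. by []. Qed.

Lemma ordmap_eq m n (f g : ordmap m n) : (forall i, f i = g i :> nat) -> f = g.
Proof. by move=> fg; apply: ordmapP => i; apply/ord_inj/fg. Qed.

Lemma ord_compA k l m n (f : ordmap m n) (g : ordmap l m) (h : ordmap k l) :
  ord_comp f (ord_comp g h) = ord_comp (ord_comp f g) h.
Proof. exact: ordmapP. Qed.

Lemma ord_comp_id m n (t : ordmap m n) : ord_comp t (ord_id m) = t.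
Proof. exact: ordmapP. Qed.

Lemma ord_id_comp m n (t : ordmap m n) : ord_comp (ord_id n) t = t.
Proof. exact: ordmapP. Qed.

Lemma ordmap_le m n (t : ordmap m n) (i j : 'I_m.+1) :
  (i <= j)%N -> (t i <= t j)%N.
Proof. by move=> ij; apply: (@omorph_le _ _ _ _ t i j). Qed.

Section MakeOrdmap.
Variables (m n : nat) (f : 'I_m.+1 -> 'I_n.+1).
Hypothesis fM : forall i j : 'I_m.+1, (i <= j)%N -> (f i <= f j)%N.

Definition mk_ordmap : ordmap m n :=
  HB.pack f (Order.isOrderMorphism.Build _ 'I_m.+1 _ 'I_n.+1 f fM).

Lemma mk_ordmapE i : mk_ordmap i = f i.
Proof. by []. Qed.
End MakeOrdmap.

Section NatOrdmap.
Variables (m n : nat) (f : nat -> nat).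
Hypothesis fM : forall i j : nat, (i <= j)%N -> (f i <= f j)%N.

Lemma nat_ordmap_subproof (i j : 'I_m.+1) : (i <= j)%N ->
  ((inord (minn (f i) n) : 'I_n.+1) <= (inord (minn (f j) n) : 'I_n.+1))%N.
Proof. by move=> /fM ij; rewrite !inordK; lia. Qed.

(** The monotone map [m] -> [n] given by a monotone function on the natural
    numbers, cut off at [n]. *)
Definition nat_ordmap : ordmap m n := mk_ordmap nat_ordmap_subproof.

Lemma nat_ordmapE i : nat_ordmap i = minn (f i) n :> nat.
Proof. by rewrite /= inordK //; lia. Qed.
End NatOrdmap.

(** The face of [Delta n] spanned by a simplex, as the set of its vertices. *)
Definition img m n (t : ordmap m n) : {set 'I_n.+1} := [set t i | i in 'I_m.+1].

Lemma mem_img m n (t : ordmap m n) i : t i \in img t.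
Proof. exact: imset_f. Qed.

Lemma imgS m n (t : ordmap m n) (S : {set 'I_n.+1}) :
  (forall i, t i \in S) <-> img t \subset S.
Proof.
split=> [tS|/subsetP tS i]; last exact/tS/mem_img.
by apply/subsetP => _ /imsetP[i _ ->].
Qed.

Lemma img_comp l m n (t : ordmap m n) (f : ordmap l m) :
  img (ord_comp t f) \subset img t.
Proof. by apply/imgS => i; apply: mem_img. Qed.

Lemma notin_img m n (t : ordmap m n) j :
  (forall i, t i != j) <-> j \notin img t.
Proof.
split=> [tj|jt i].
  by apply/imsetP => -[i _ ji]; move: (tj i); rewrite ji eqxx.
by apply: contraNneq jt => <-; apply: mem_img.
Qed.

(** Families of faces closed under passing to subfaces.  The empty set may or
    may not belong to such a family; no simplex has empty image. *)
Definition down n (A : pred {set 'I_n.+1}) :=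
  forall S T : {set 'I_n.+1}, S \subset T -> A T -> A S.

Section PartialMaps.
Variable C : sSet.

(** A map from a simplicial subset of [Delta n] to [C] is encoded as a total
    assignment of simplices of [C] to the simplices of [Delta n], of which only
    the values on a down-closed family [A] of faces matter: it has to be
    natural there ([natural_on]). *)
Definition partial_map n := forall m, ordmap m n -> C m.

Definition natural_on n (A : pred {set 'I_n.+1}) (F : partial_map n) :=
  forall l m (f : ordmap l m) (t : ordmap m n),
  A (img t) -> F l (ord_comp t f) = act f (F m t).

Definition agree_on n (A : pred {set 'I_n.+1}) (F G : partial_map n) :=
  forall m (t : ordmap m n), A (img t) -> F m t = G m t.

(** The union of two partial maps. *)
Definition glue n (A : pred {set 'I_n.+1}) (F G : partial_map n) : partial_map n :=
  fun m t => if A (img t) then F m t else G m t.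

Lemma glue_natural n (A B : pred {set 'I_n.+1}) F G : down A -> down B ->
  natural_on A F -> natural_on B G -> agree_on (predI A B) F G ->
  natural_on (predU A B) (glue A F G).
Proof.
move=> dA dB nF nG FG l m f t /=; rewrite /glue.
have ti := img_comp t f.
have [At _|At /= Bt] := boolP (A (img t)); first by rewrite (dA _ _ ti At) nF.
rewrite -nG //.
by case: ifPn => [Atf|//]; apply: FG; rewrite /= Atf (dB _ _ ti Bt).
Qed.

Lemma glue_agreel n (A : pred {set 'I_n.+1}) F G : agree_on A (glue A F G) F.
Proof. by move=> m t At; rewrite /glue At. Qed.

Lemma glue_agreer n (A B : pred {set 'I_n.+1}) F G :
  agree_on (predI A B) F G -> agree_on B (glue A F G) G.
Proof.
by move=> FG m t Bt; rewrite /glue; case: ifP => // At; apply: FG; apply/andP.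
Qed.

(** The faces of the horn at [k], resp. of the boundary, of [Delta n]. *)
Definition horn_pred n (k : 'I_n.+1) : pred {set 'I_n.+1} :=
  fun S => [exists j, (j != k) && (j \notin S)].

Definition bd_pred n : pred {set 'I_n.+1} := fun S => [exists j, j \notin S].

Lemma horn_memE n (k : 'I_n.+1) m (t : ordmap m n) :
  horn_mem k t <-> horn_pred k (img t).
Proof.
split=> [[j jk /notin_img jt]|/existsP[j /andP[jk /notin_img jt]]].
  by apply/existsP; exists j; rewrite jk.
by exists j.
Qed.

Lemma boundary_memE n m (t : ordmap m n) :
  boundary_mem t <-> bd_pred (img t).
Proof.
by split=> [[j /notin_img jt]|/existsP[j /notin_img jt]];
  [apply/existsP|]; exists j.
Qed.

(** Inner horn filling for partial maps. *)
Lemma horn_fill (hC : quasicategory C) n (k : 'I_n.+1) (F : partial_map n) :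
  0 < k < n -> natural_on (horn_pred k) F ->
  exists z : C n, agree_on (horn_pred k) F (fun m t => act t z).
Proof.
move=> kn nF.
have un l m (f : ordmap l m) (s : horn k m) :
    F l (sval (act f s)) = act f (F m (sval s)).
  by case: s => t ht; apply: nF; apply/horn_memE.
pose u : sMap (horn k) C := SMap un.
have [v vu] := hC n k kn u.
exists (v n (ord_id n)) => m t /horn_memE ht.
have -> : F m t = u m (exist _ t ht) by [].
rewrite -vu /= -smap_act; congr smap; exact: ordmapP.
Qed.

(** The face of [Delta n] on a vertex set [S] with [m.+1] elements, as an
    injective monotone map [face : [m] -> [n]], together with a monotone
    retraction [face_retr].  The retraction counts the elements of [S] below a
    given vertex. *)
Section Faces.
Variables (n m : nat) (S : {set 'I_n.+1}).
Hypothesis Sm : #|S| = m.+1.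

Definition rank (i : 'I_n.+1) : nat := #|[set j in S | (j < i)%N]|.

Lemma rank_le (i j : 'I_n.+1) : (i <= j)%N -> (rank i <= rank j)%N.
Proof.
move=> ij; apply/subset_leq_card/subsetP => k; rewrite !inE => /andP[-> ki].
exact: leq_trans ki ij.
Qed.

Lemma rank_lt (i j : 'I_n.+1) : i \in S -> (i < j)%N -> (rank i < rank j)%N.
Proof.
move=> iS ij; apply/proper_card/properP; split.
  by apply/subsetP => k; rewrite !inE => /andP[-> ki]; apply: ltn_trans ki ij.
by exists i; rewrite !inE iS //= ltnn.
Qed.

Lemma rank_ub i : i \in S -> (rank i < m.+1)%N.
Proof.
move=> iS; rewrite -Sm; apply/proper_card/properP; split.
  by apply/subsetP => k; rewrite !inE => /andP[].
by exists i => //; rewrite !inE ltnn andbF.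
Qed.

Lemma face_retr_subproof (i j : 'I_n.+1) : (i <= j)%N ->
  ((inord (minn (rank i) m) : 'I_m.+1) <=
   (inord (minn (rank j) m) : 'I_m.+1))%N.
Proof. by clear Sm; move=> /rank_le ij; rewrite !inordK; lia. Qed.

Definition face_retr : ordmap n m := mk_ordmap face_retr_subproof.

Lemma face_retrE i : i \in S -> face_retr i = rank i :> nat.
Proof. by move=> /rank_ub iS; rewrite /= inordK; lia. Qed.

Lemma face_retr_inj : {in S &, injective face_retr}.
Proof.
move=> i j iS jS /(congr1 (@nat_of_ord _)); rewrite !face_retrE // => rij.
apply/val_inj => /=; case: (ltngtP i j) => // /rank_lt.
  by move=> /(_ iS); rewrite rij ltnn.
by move=> /(_ jS); rewrite rij ltnn.
Qed.

Lemma face_surj (k : 'I_m.+1) : exists i, (i \in S) && (face_retr i == k).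
Proof.
have : k \in face_retr @: S.
  suff -> : face_retr @: S = [set: 'I_m.+1] by rewrite inE.
  apply/eqP; rewrite eqEcard subsetT cardsT card_ord.
  by rewrite (card_in_imset face_retr_inj) Sm /=.
by case/imsetP => i iS ->; exists i; rewrite iS eqxx.
Qed.

Definition face_fun (k : 'I_m.+1) := xchoose (face_surj k).

Lemma face_funS k : face_fun k \in S.
Proof. by case/andP: (xchooseP (face_surj k)). Qed.

Lemma face_funK k : face_retr (face_fun k) = k.
Proof. by apply/eqP; case/andP: (xchooseP (face_surj k)). Qed.

Lemma face_subproof (i j : 'I_m.+1) :
  (i <= j)%N -> (face_fun i <= face_fun j)%N.
Proof.
move=> ij; rewrite leqNgt; apply/negP => /rank_lt -/(_ (face_funS j)).
by rewrite -!face_retrE ?face_funS // !face_funK ltnNge ij.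
Qed.

Definition face : ordmap m n := mk_ordmap face_subproof.

Lemma face_retrK : {in S, cancel face_retr face}.
Proof.
move=> i iS; apply: face_retr_inj => //; first exact: face_funS.
exact: face_funK.
Qed.
End Faces.

(** If all facets of the face [S] except the one opposite to [k] belong to [A],
    and [k] is an inner vertex of [S], then a partial map on [A] extends to
    [S]. *)
Lemma extend_face (hC : quasicategory C) n (A : pred {set 'I_n.+1})
    (F : partial_map n) (S : {set 'I_n.+1}) (k a b : 'I_n.+1) :
  down A -> natural_on A F ->
  k \in S -> a \in S -> b \in S -> (a < k < b)%N ->
  (forall j, j \in S -> j != k -> A (S :\ j)) -> ~~ A (S :\ k) ->
  exists2 G : partial_map n, natural_on (predU A (fun T => T \subset S)) G
    & agree_on A G F.
Proof.
move=> dA nF kS aS bS /andP[ak kb] Aj Ak.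
have [m Sm] : exists m, #|S| = m.+1.
  by exists #|S|.-1; rewrite prednK //; apply/card_gt0P; exists k.
pose r := face_retr m S; pose d := face Sm.
have rE i : i \in S -> r i = rank S i :> nat by exact: face_retrE.
have dr i : i \in S -> d (r i) = i by move=> iS; apply: face_retrK.
have rd i : r (d i) = i by apply: face_funK.
have dS i : d i \in S by apply: face_funS.
have rk : (0 < r k < m)%N.
  rewrite rE //; have := rank_lt aS ak; have := rank_lt kS kb.
  have := rank_ub Sm bS; lia.
(* Seen through [d], the faces of [S] that lie in [A] are exactly those of the
   horn at [r k]. *)
have HA l (t : ordmap l m) : horn_pred (r k) (img t) -> A (img (ord_comp d t)).
  move=> /existsP[j /andP[jk jt]]; apply: dA (Aj (d j) (dS j) _); last first.
    by apply: contraNneq jk => <-; rewrite rd.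
  apply/imgS => i; rewrite !inE dS andbT; apply: contraNneq jt => /(congr1 r).
  by rewrite !rd => <-; apply: mem_img.
have AH l (t : ordmap l n) : img t \subset S -> A (img t) ->
    horn_pred (r k) (img (ord_comp r t)).
  move=> tS At; apply: contraNT Ak => /existsPn rt; apply: dA At.
  apply/subsetP => j; rewrite !inE => /andP[jk jS].
  have rI i i' : i \in S -> i' \in S -> r i = r i' -> i = i'.
    by move=> iS i'S rii; rewrite -(dr i) // rii dr.
  have := rt (r j); rewrite negb_and !negbK => /orP[/eqP/(rI _ _ jS kS) jk'|].
    by rewrite jk' eqxx in jk.
  case/imsetP => i _ /(rI _ _ jS) ->; first exact: mem_img.
  exact/(imgS t S).2.
have [l l' f t Ht|z zP] :=
  @horn_fill hC m (r k) (fun l t => F l (ord_comp d t)) rk.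
  by rewrite ord_compA nF //; apply: HA.
exists (glue A F (fun l t => act (ord_comp r t) z)); last exact: glue_agreel.
apply: glue_natural => //.
- by move=> T T' TT' /(subset_trans TT').
- by move=> l l' f t _; rewrite ord_compA act_comp.
move=> l t /andP[At tS].
rewrite -zP ?AH //; congr F; apply: ordmapP => i.
by rewrite !ord_compE dr //; apply/(imgS t S).2.
Qed.

(** The faces of [A'] outside [A] are paired off by adding or removing [c], and
    [c] is always an inner vertex of the larger face of the pair. *)
Definition toggle_stable n (A A' : pred {set 'I_n.+1}) (c : 'I_n.+1) :=
  forall S, A' S -> ~~ A S ->
    [/\ A' (c |: S), ~~ A (S :\ c) &
        exists a b, [/\ a \in S, b \in S & (a < c < b)%N]].

(** By induction on the number of missing faces: a missing face [S] that
    contains [c] and is minimal as such has all its facets in [A], except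
    [S :\ c]; so one inner horn adds the pair [S], [S :\ c]. *)
Lemma extend_toggle (hC : quasicategory C) n (A A' : pred {set 'I_n.+1})
    (c : 'I_n.+1) (F : partial_map n) :
  down A -> down A' -> (forall S, A S -> A' S) ->
  toggle_stable A A' c -> natural_on A F ->
  exists2 G : partial_map n, natural_on A' G & agree_on A G F.
Proof.
move=> dA dA' AA' tog nF.
have [N] := ubnP #|[pred S | A' S && ~~ A S]|.
elim: N => // N IH in A F dA AA' tog nF *; rewrite ltnS => leN.
have [[S0 /andP[S0A' S0A]]|none] :=
  pselect (exists S, A' S && ~~ A S); last first.
  exists F => // l m f t A't; apply: nF; apply: contra_notT none => At.
  by exists (img t); rewrite A't.
pose P := [pred S | [&& A' S, ~~ A S & c \in S]].
have P0 : P (c |: S0).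
  have [cA' _ _] := tog _ S0A' S0A; rewrite /= cA' setU11 andbT.
  by apply: contra S0A; apply: dA; apply: subsetU1.
case: (arg_minnP (fun S : {set 'I_n.+1} => #|S|) P0) =>
  S /and3P[SA' SA cS] minS.
have [_ ScA [a [b [aS bS acb]]]] := tog _ SA' SA.
have Aj j : j \in S -> j != c -> A (S :\ j).
  move=> jS jc; apply: contraT => nA.
  have : P (S :\ j).
    by rewrite /= nA !inE eq_sym jc cS (dA' _ _ (subsetDl _ _) SA').
  by move/minS; rewrite (cardsD1 j S) jS add1n ltnn.
have [G nG GF] := extend_face hC dA nF cS aS bS acb Aj ScA.
have dAS : down (predU A (fun T => T \subset S)).
  move=> T T' TT' /= /orP[/(dA _ _ TT') -> //|T'S].
  by rewrite orbC (subset_trans TT').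
have [|||G' nG' GG'] := IH _ _ dAS _ _ nG.
- by move=> T /= /orP[/AA' //|/dA']; apply.
- move=> T TA' /=; rewrite negb_or => /andP[TA TS].
  have [cT Tc ab] := tog _ TA' TA; split => //=.
  rewrite negb_or Tc; apply: contra TS => /subsetP TS; apply/subsetP => i iT.
  by have [->//|ic] := eqVneq i c; apply: TS; rewrite !inE ic.
- apply: leq_trans leN; apply/proper_card/properP; split.
    by apply/subsetP => T; rewrite !inE /= negb_or => /andP[-> /andP[->]].
  by exists S; rewrite !inE /= ?SA' // subxx orbT.
exists G' => // m t At; rewrite GG' ?GF //=; by rewrite /= At.
Qed.

End PartialMaps.

(** * Composition of edges up to homotopy *)

Section Edges.
Variable C : sSet.

(** Faces indexed by natural numbers; only [i <= n.+1] is meaningful. *)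
Definition dface n (i : nat) (s : C n.+1) : C n := act (coface (inord i)) s.

Lemma dface_dface n i j (s : C n.+2) : (i < j <= n.+2)%N ->
  dface i (dface j s) = dface j.-1 (dface i s).
Proof.
move=> ij; rewrite /dface -!act_comp; congr act; apply: ordmapP => k.
apply: val_inj; rewrite !ord_compE /= !inordK; try lia.
by rewrite /bump; lia.
Qed.

Lemma skip_subproof (j : nat) (a b : nat) : (a <= b)%N ->
  (unbump j a <= unbump j b)%N.
Proof. rewrite /unbump; lia. Qed.

(** A retraction of the [j]-th coface map, defined for [j <= n.+1].  It differs
    from the codegeneracies in that the vertex [n.+1] is allowed as [j]. *)
Definition skip n (j : nat) : ordmap n.+1 n :=
  nat_ordmap n.+1 n (@skip_subproof j).

Lemma skip_val n j (i : 'I_n.+2) : (j <= n.+1)%N -> i != j :> nat ->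
  skip n j i = unbump j i :> nat.
Proof.
move=> jn ij; rewrite nat_ordmapE; have := ltn_ord i; rewrite /unbump; lia.
Qed.

Lemma coface_skip n m (j : nat) (t : ordmap m n.+1) : (j <= n.+1)%N ->
  (forall i, t i != j :> nat) ->
  ord_comp (coface (inord j)) (ord_comp (skip n j) t) = t.
Proof.
move=> jn tj; apply: ordmapP => i; apply: val_inj.
rewrite !ord_compE /= -/(nat_of_ord _) skip_val // inordK //.
by have := tj i; rewrite /bump /unbump; lia.
Qed.

(** The faces of [Delta n] that miss some vertex in [K]. *)
Definition misses n (K : pred nat) : pred {set 'I_n.+1} :=
  fun S => [exists j : 'I_n.+1, K j && (j \notin S)].

(** Simplices [y j], for [j] in [K], with compatible faces glue to a map on the
    union of the facets of [Delta n.+2] opposite to the vertices in [K]. *)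
Lemma glue_faces n (K : pred nat) (y : nat -> C n.+1) :
  (forall i j : nat, (i < j <= n.+2)%N -> K i -> K j ->
     dface i (y j) = dface j.-1 (y i)) ->
  exists2 F : partial_map C n.+2, natural_on (misses K) F &
    forall j, (j <= n.+2)%N -> K j -> F _ (coface (inord j)) = y j.
Proof.
move=> yc.
pose f m (t : ordmap m n.+2) (j : nat) := act (ord_comp (skip n.+1 j) t) (y j).
have fc m (t : ordmap m n.+2) (i j : nat) : (i < j <= n.+2)%N ->
    K i -> K j -> (forall l, t l != i :> nat) ->
    (forall l, t l != j :> nat) -> f m t i = f m t j.
  move=> ij Ki Kj ti tj; rewrite /f.
  pose u := ord_comp (skip n i) (ord_comp (skip n.+1 j) t).
  have -> : ord_comp (skip n.+1 j) t = ord_comp (coface (inord i)) u.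
    rewrite coface_skip //; first lia.
    move=> l; rewrite ord_compE skip_val //; last lia.
    by have := ti l; have := tj l; rewrite /unbump; lia.
  have -> : ord_comp (skip n.+1 i) t = ord_comp (coface (inord j.-1)) u.
    apply: ordmapP => l; apply: val_inj; rewrite /u /= -!/(nat_of_ord _).
    have := ti l; have := tj l; have := ltn_ord (t l) => tln tlj tli.
    rewrite !skip_val // ?inordK //; rewrite /bump /unbump; lia.
  by have := yc i j ij Ki Kj; rewrite /dface !act_comp => ->.
pose F m (t : ordmap m n.+2) : C m :=
  if [pick j : 'I_n.+3 | K j && (j \notin img t)] is Some j then f m t j
  else f m t 0.
have FE m (t : ordmap m n.+2) (j : 'I_n.+3) : K j -> j \notin img t ->
    F m t = f m t j.
  move=> Kj jt; rewrite /F; case: pickP => [i /andP[Ki it]|/(_ j)]; last first.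
    by rewrite Kj jt.
  have it' := (notin_img t i).2 it; have jt' := (notin_img t j).2 jt.
  have in3 := ltn_ord i; have jn3 := ltn_ord j.
  case: (ltngtP i j) => ij; last by rewrite ij.
    by apply: fc => //; lia.
  by apply/esym/fc => //; lia.
exists F => [l m g t /existsP[j /andP[Kj jt]]|j jn Kj].
  have jtg : j \notin img (ord_comp t g).
    by apply: contra jt; apply: (subsetP (img_comp _ _)).
  by rewrite (FE _ _ j Kj jt) (FE _ _ j Kj jtg) /f ord_compA act_comp.
have jE : (inord j : 'I_n.+3) = j :> nat by rewrite inordK.
rewrite (FE _ _ (inord j)) ?jE //; last first.
  by apply/notin_img => i; rewrite eq_sym; apply: neq_lift.
rewrite /f -[RHS]act_id; congr act; apply: ordmapP => i.
apply: ord_inj; rewrite ord_compE skip_val //=; first by rewrite jE bumpK.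
by rewrite jE eq_sym neq_bump.
Qed.

Lemma fill_faces (hC : quasicategory C) n (k : 'I_n.+3) (y : nat -> C n.+1) :
  0 < k < n.+2 ->
  (forall i j : nat, (i < j <= n.+2)%N -> i <> k -> j <> k ->
     dface i (y j) = dface j.-1 (y i)) ->
  exists z : C n.+2, forall j : nat, (j <= n.+2)%N -> j <> k -> dface j z = y j.
Proof.
move=> kn yc.
have [|F nF FE] := @glue_faces n (predC1 (k : nat)) y.
  by move=> i j ij /eqP ik /eqP jk; apply: yc.
have [z zP] := horn_fill hC kn nF.
exists z => j jn /eqP jk; rewrite /dface -(FE j) // zP //.
have jE : (inord j : 'I_n.+3) = j :> nat by rewrite inordK.
apply/existsP; exists (inord j); rewrite -(inj_eq (@ord_inj _)) jE jk.
by apply/notin_img => i; rewrite eq_sym; apply: neq_lift.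
Qed.

(** The degenerate edge on a vertex, that is, its identity. *)
Definition degen0 (x : C 0) : C 1 := act (codegen ord0) x.

(** [h] is a composite of [e] followed by [g]: some triangle has edges [e] from
    [0] to [1], [g] from [1] to [2] and [h] from [0] to [2]. *)
Definition comp2 (e g h : C 1) :=
  exists s : C 2, [/\ dface 2 s = e, dface 0 s = g & dface 1 s = h].

Lemma comp2_ex (hC : quasicategory C) e g : dface 0 e = dface 1 g ->
  exists h, comp2 e g h.
Proof.
move=> eg.
have [||z zP] := @fill_faces hC 0 (inord 1) (fun j => if j == 0 then g else e).
  by rewrite inordK.
- by rewrite inordK // => -[|[|[|i]]] [|[|[|j]]] //= /andP[].
exists (dface 1 z); exists z; split => //.
  by rewrite (zP 2) // inordK.
by rewrite (zP 0) // inordK.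
Qed.

(** The two forms of associativity, by filling a tetrahedron from the three
    given triangles. *)
Lemma comp2_assocl (hC : quasicategory C) e f g ef fg h :
  comp2 e f ef -> comp2 f g fg -> comp2 ef g h -> comp2 e fg h.
Proof.
move=> [s3 [s32 s30 s31]] [s0 [s02 s00 s01]] [s1 [s12 s10 s11]].
have [||z zP] := @fill_faces hC 1 (inord 2)
  (fun j => if j == 0 then s0 else if j == 1 then s1 else s3).
  by rewrite inordK.
- rewrite inordK // => -[|[|[|[|i]]]] [|[|[|[|j]]]] //= ij _ _;
    try by case/andP: ij.
  + by rewrite s10 s00.
  + by rewrite s30 s02.
  + by rewrite s31 s12.
rewrite inordK // in zP; exists (dface 2 z); split.
- by rewrite -(@dface_dface _ 2 3) // zP.
- by rewrite (@dface_dface _ 0 2) // zP.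
- by rewrite (@dface_dface _ 1 2) // zP.
Qed.

Lemma comp2_assocr (hC : quasicategory C) e f g ef fg h :
  comp2 e f ef -> comp2 f g fg -> comp2 e fg h -> comp2 ef g h.
Proof.
move=> [s3 [s32 s30 s31]] [s0 [s02 s00 s01]] [s1 [s12 s10 s11]].
have [||z zP] := @fill_faces hC 1 (inord 1)
  (fun j => if j == 0 then s0 else if j == 2 then s1 else s3).
  by rewrite inordK.
- rewrite inordK // => -[|[|[|[|i]]]] [|[|[|[|j]]]] //= ij _ _;
    try by case/andP: ij.
  + by rewrite s10 s01.
  + by rewrite s30 s02.
  + by rewrite s32 s12.
rewrite inordK // in zP; exists (dface 1 z); split.
- by rewrite -(@dface_dface _ 1 3) // zP.
- by rewrite (@dface_dface _ 0 1) // zP.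
- by rewrite -(@dface_dface _ 1 2) // zP.
Qed.

Lemma codegenE n (i : 'I_n.+1) j : codegen i j = unbump i j :> nat.
Proof. exact: codegen_val. Qed.

Lemma cofaceE n i (j : 'I_n.+1) : (i <= n.+1)%N ->
  coface (inord i) j = bump i j :> nat.
Proof. by move=> ij; rewrite /= inordK. Qed.

Lemma act_eq m n (f g : ordmap m n) (z : C n) :
  (forall i, f i = g i :> nat) -> act f z = act g z.
Proof.
by move=> fg; congr act; apply: ordmapP => i; apply/ord_inj/fg.
Qed.

Lemma act_eq_id n (f : ordmap n n) (z : C n) :
  (forall i, f i = i :> nat) -> act f z = z.
Proof. by move=> fi; rewrite -[RHS]act_id; apply: act_eq. Qed.

Lemma comp2_1r (e : C 1) : comp2 e (degen0 (dface 0 e)) e.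
Proof.
exists (act (codegen ord_max) e); rewrite /degen0 /dface -!act_comp.
split; [apply: act_eq_id|apply: act_eq|apply: act_eq_id] => j;
  rewrite !(ord_compE, codegenE, cofaceE) //; by case: j => -[|[]].
Qed.

Lemma comp2_1l (e : C 1) : comp2 (degen0 (dface 1 e)) e e.
Proof.
exists (act (codegen ord0) e); rewrite /degen0 /dface -!act_comp.
split; [apply: act_eq|apply: act_eq_id|apply: act_eq_id] => j;
  rewrite !(ord_compE, codegenE, cofaceE) //; by case: j => -[|[]].
Qed.

Lemma dface_degen0 i (x : C 0) : dface i (degen0 x) = x.
Proof.
rewrite /degen0 /dface -!act_comp -[RHS]act_id; congr act; apply: ordmapP => j.
by rewrite !ord1.
Qed.

Lemma comp2_ends e g h : comp2 e g h ->
  [/\ dface 1 h = dface 1 e, dface 0 h = dface 0 g & dface 0 e = dface 1 g].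
Proof.
case=> s [<- <- <-]; split.
- by rewrite -(@dface_dface _ 1 2).
- by rewrite -(@dface_dface _ 0 1).
- by rewrite (@dface_dface _ 0 2).
Qed.

(** Homotopy of edges with the same end points. *)
Definition homotopic (e h : C 1) := comp2 e (degen0 (dface 0 e)) h.

Lemma homotopic_refl e : homotopic e e. Proof. exact: comp2_1r. Qed.

Lemma homotopic_trans (hC : quasicategory C) e f g :
  homotopic e f -> homotopic f g -> homotopic e g.
Proof.
move=> ef fg; have [_ fe _] := comp2_ends ef.
rewrite dface_degen0 in fe; rewrite /homotopic fe in fg.
apply: comp2_assocl hC _ _ _ _ _ _ ef _ fg.
by have := comp2_1r (degen0 (dface 0 e)); rewrite dface_degen0.
Qed.

Lemma homotopic_comp2 (hC : quasicategory C) e e' g h :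
  homotopic e e' -> comp2 e' g h -> comp2 e g h.
Proof.
move=> ee' e'gh.
have [_ e'e _] := comp2_ends ee'; have [_ _ e'g] := comp2_ends e'gh.
rewrite dface_degen0 in e'e.
apply: comp2_assocl hC _ _ _ _ _ _ ee' _ e'gh.
by rewrite -e'e e'g; apply: comp2_1l.
Qed.

Lemma comp2_homotopic (hC : quasicategory C) e g h h' :
  comp2 e g h -> homotopic h h' -> comp2 e g h'.
Proof.
move=> egh hh'; have [_ hg _] := comp2_ends egh.
apply: comp2_assocl hC _ _ _ _ _ _ egh _ hh'.
by rewrite hg; apply: comp2_1r.
Qed.

Lemma dface_coface n (j : 'I_n.+2) (s : C n.+1) : act (coface j) s = dface j s.
Proof. by rewrite /dface inord_val. Qed.

Lemma edge_ends (x y : C 0) (e : edge x y) :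
  dface 1 (sval e) = x /\ dface 0 (sval e) = y.
Proof. by case: e => e /=; rewrite !dface_coface. Qed.

Lemma mk_edge_subproof (x y : C 0) (e : C 1) : dface 1 e = x -> dface 0 e = y ->
  act (coface ord_max) e = x /\ act (coface ord0) e = y.
Proof. by move=> <- <-; rewrite !dface_coface. Qed.

Definition mk_edge (x y : C 0) (e : C 1) (ex : dface 1 e = x)
    (ey : dface 0 e = y) : edge x y :=
  exist _ e (mk_edge_subproof ex ey).

(** The action of a path on edges ending at its source: [path_act p f h] holds
    when [h] is obtained from [f] by composing with the edges of [p] one after
    the other, and then up to homotopy.  This relation only depends on the
    class of [p] in the homotopy category ([path_act_cong]). *)
Fixpoint path_act (x y : C 0) (p : epath x y) : C 1 -> C 1 -> Prop :=
  match p with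
  | enil _ => homotopic
  | econs _ _ _ e q => fun f h => exists2 g, comp2 f (sval e) g & path_act q g h
  end.

Section PathAct.
Hypothesis hC : quasicategory C.

Lemma path_act_homotopic x y (p : epath x y) f g h :
  homotopic f g -> path_act p g h -> path_act p f h.
Proof.
elim: p f g => [z|z z' w e p IH] f g /=; first exact: homotopic_trans.
by move=> fg [k gk kh]; exists k => //; apply: homotopic_comp2 gk.
Qed.

Lemma path_act_cat x y z (p : epath x y) (q : epath y z) f h :
  path_act (ecat p q) f h <-> exists2 g, path_act p f g & path_act q g h.
Proof.
elim: p q f => [w|w w' w'' e p IH] q f /=.
  split=> [qfh|[g fg]]; first by exists f => //; apply: homotopic_refl.
  exact: path_act_homotopic.
split=> [[g fg /IH[k gk kh]]|[k [g fg gk kh]]].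
  by exists k => //; exists g.
by exists g => //; apply/IH; exists k.
Qed.

Lemma path_act_cong x y (p q : epath x y) : econg p q ->
  forall f h, dface 0 f = x -> path_act p f h <-> path_act q f h.
Proof.
have act_end a b (r : epath a b) f h :
    dface 0 f = a -> path_act r f h -> dface 0 h = b.
  elim: r f => [z|z z' w e r IH] f /=.
    by move=> <- /comp2_ends[_ -> _]; rewrite dface_degen0.
  by move=> fz [g /comp2_ends[_ ge _]]; apply: IH; rewrite ge;
    case: (edge_ends e).
elim=> {x y p q}.
- by [].
- by move=> x y p q _ IH f h fx; rewrite IH.
- by move=> x y p q r _ IH1 _ IH2 f h fx; rewrite IH1 ?IH2.
- move=> x y z p p' q q' _ IHp _ IHq f h fx; rewrite !path_act_cat.
  split=> -[g fg gh]; exists g.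
  + exact/(IHp _ _ fx).1.
  + exact: (IHq _ _ (act_end _ _ _ _ _ fx fg)).1.
  + exact/(IHp _ _ fx).2.
  + exact: (IHq _ _ (act_end _ _ _ _ _ fx fg)).2.
- move=> x e eE f h fx /=; rewrite eE -/(degen0 x) -fx -/(homotopic _ _).
  split=> [[g fg]|fh]; first exact: homotopic_trans.
  by exists f => //; apply: homotopic_refl.
- move=> x y z f g h s s2 s0 s1 k l kx /=.
  have fgh : comp2 (sval f) (sval g) (sval h).
    by exists s; rewrite -s2 -s0 -s1 !dface_coface.
  split=> [[m khm ml]|[m kfm [o mgo ol]]].
    have [n kfn] : exists n, comp2 k (sval f) n.
      by apply: comp2_ex => //; rewrite kx; case: (edge_ends f).
    exists n => //; exists m => //; exact: comp2_assocr fgh khm.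
  by exists o => //; apply: comp2_assocl fgh mgo.
Qed.

(** Every path can be composed to a single edge. *)
Lemma path_edge x y (p : epath x y) :
  exists e : C 1, dface 1 e = x /\ dface 0 e = y.
Proof.
suff H f : dface 0 f = x ->
    exists e : C 1, dface 1 e = dface 1 f /\ dface 0 e = y.
  by have := H (degen0 x); rewrite !dface_degen0; apply.
elim: p f => [z|z z' w e p IH] f fz; first by exists f.
have [ez ez'] := edge_ends e.
have [|g feg] := @comp2_ex hC f (sval e); first by rewrite fz.
have [gf ge _] := comp2_ends feg.
have [|h [hg hw]] := IH g; first by rewrite ge.
by exists h; rewrite hg gf.
Qed.

Lemma h_initial_edge (x y : C 0) : h_initial x ->
  exists e : C 1, dface 1 e = x /\ dface 0 e = y.
Proof. by move=> /(_ y)[f _]; apply: (path_edge (ho_repr f)). Qed.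

(** Every edge [r] into an h-initial object has a section, exhibited by a
    triangle. *)
Lemma h_initial_section (r : C 1) : h_initial (dface 0 r) ->
  exists s, comp2 s r (degen0 (dface 0 r)).
Proof.
set x := dface 0 r => xI.
have [e [ex ey]] := h_initial_edge (dface 1 r) xI.
have [f [_ fU]] := xI x.
have : econg (ecat (epath1 (mk_edge ex ey)) (epath1 (mk_edge erefl erefl)))
             (enil x).
  by apply/ho_classP; rewrite -(fU (ho_class _)) // -(fU (ho_class (enil x))).
(* Let both paths act on the identity of [x]; the section is the composite of
   the identity with the edge [e]. *)
move/path_act_cong => /(_ (degen0 x) (degen0 x)); rewrite dface_degen0.
case=> // _ /(_ (homotopic_refl _)) [s _ [h srh hx]].
by exists s; apply: comp2_homotopic hx.
Qed.
End PathAct.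
End Edges.

(** * h-initial objects fill boundaries *)

Section BoundaryFilling.
Variable C : sSet.

(** Every map from the boundary of [Delta n.+1] to [C] that sends the vertex [0]
    to [x] extends to [Delta n.+1]. *)
Definition fills_boundaries (x : C 0) := forall n (F : partial_map C n.+1),
  natural_on (@bd_pred n.+1) F -> F 0 (ord_const 0 ord0) = x ->
  exists z : C n.+1, agree_on (@bd_pred n.+1) F (fun m t => act t z).

(** Every map from the boundary of [Delta n.+1] to [C] has a cone over it.  The
    join of a point and this boundary is the horn of [Delta n.+2] at the vertex
    [0], the new point being that vertex. *)
Definition has_boundary_cones := forall n (F : partial_map C n.+1),
  natural_on (@bd_pred n.+1) F ->
  exists2 Q : partial_map C n.+2, natural_on (@horn_pred n.+2 ord0) Q &
    forall m (t : ordmap m n.+1), bd_pred (img t) ->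
      Q m (ord_comp (coface ord0) t) = F m t.

(** The construction of the filler inside [Delta n.+3]. *)
Section Filler.
Variable n : nat.

Local Notation N := n.+3.
Definition below (k : nat) : pred {set 'I_N.+1} :=
  fun S => [forall i in S, (i <= k)%N].
Definition without (k : nat) : pred {set 'I_N.+1} :=
  fun S => [forall i in S, i != k :> nat].
Definition misses_from (k : nat) : pred {set 'I_N.+1} :=
  fun S => [exists j : 'I_N.+1, (k <= j)%N && (j \notin S)].

Lemma belowP k (S : {set 'I_N.+1}) :
  reflect (forall i, i \in S -> (i <= k)%N) (below k S).
Proof. exact: forall_inP. Qed.

Lemma withoutP k (S : {set 'I_N.+1}) :
  reflect (forall i, i \in S -> i != k :> nat) (without k S).
Proof. exact: forall_inP. Qed.

Lemma misses_fromP k (S : {set 'I_N.+1}) :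
  reflect (exists2 j : 'I_N.+1, (k <= j)%N & j \notin S) (misses_from k S).
Proof. exact: exists_inP. Qed.

Lemma down_below k : down (below k).
Proof. by move=> S T /subsetP ST /belowP H; apply/belowP => i /ST /H. Qed.

Lemma down_without k : down (without k).
Proof. by move=> S T /subsetP ST /withoutP H; apply/withoutP => i /ST /H. Qed.

Lemma down_misses k : down (misses_from k).
Proof.
move=> S T /subsetP ST /misses_fromP[j kj jT].
apply/misses_fromP; exists j => //.
by apply: contra jT => /ST.
Qed.

Lemma down_I (A B : pred {set 'I_N.+1}) : down A -> down B -> down (predI A B).
Proof.
by move=> dA dB S T ST /andP[/(dA _ _ ST) AS /(dB _ _ ST) BS]; apply/andP.
Qed.

Lemma down_U (A B : pred {set 'I_N.+1}) : down A -> down B -> down (predU A B).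
Proof.
move=> dA dB S T ST /orP[/(dA _ _ ST) AS|/(dB _ _ ST) BS];
  by apply/orP; auto.
Qed.

(** The faces on which the triangle, the cone and the given boundary map define
    a map, and the two larger families to which that map gets extended. *)
Definition triangle_faces := below 2.
Definition cone_faces := predI (without 0) (misses_from 2).
Definition base_faces := predI (without 1) (misses_from 3).
Definition start_faces := predU triangle_faces (predU cone_faces base_faces).
Definition middle_faces := predU start_faces (misses_from 3).
Definition final_faces := predU middle_faces (without 2).

Lemma down_triangle : down triangle_faces. Proof. exact: down_below. Qed.
Lemma down_cone : down cone_faces.
Proof. exact: down_I (@down_without _) (@down_misses _). Qed.
Lemma down_base : down base_faces.
Proof. exact: down_I (@down_without _) (@down_misses _). Qed.
Lemma down_cone_base : down (predU cone_faces base_faces).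
Proof. exact: down_U down_cone down_base. Qed.
Lemma down_start : down start_faces.
Proof. exact: down_U down_triangle down_cone_base. Qed.
Lemma down_middle : down middle_faces.
Proof. exact: down_U down_start (@down_misses _). Qed.
Lemma down_final : down final_faces.
Proof. exact: down_U down_middle (@down_without _). Qed.

Lemma not_without k (S : {set 'I_N.+1}) :
  ~~ without k S -> exists2 i : 'I_N.+1, i \in S & i = k :> nat.
Proof. by move/forall_inPn => [i iS]; rewrite negbK => /eqP; exists i. Qed.

Lemma not_below k (S : {set 'I_N.+1}) :
  ~~ below k S -> exists2 i : 'I_N.+1, i \in S & (k < i)%N.
Proof. by move/forall_inPn => [i iS]; rewrite -ltnNge; exists i. Qed.

Lemma misses_le k l (S : {set 'I_N.+1}) :
  (k <= l)%N -> misses_from l S -> misses_from k S.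
Proof.
move=> kl /misses_fromP[j lj jS]; apply/misses_fromP; exists j => //.
by ord_lia.
Qed.

(** The new faces are those that contain [0], [1], at least one but not all of
    the vertices [>= 3]. *)
Lemma toggle_two : toggle_stable start_faces middle_faces (inord 2).
Proof.
have v2 : (inord 2 : 'I_N.+1) = 2 :> nat by rewrite inordK.
move=> S /orP[->//|mS]; rewrite /= !negb_or !negb_and mS orbF.
rewrite (misses_le _ mS) // orbF => /and3P[/not_below[k kS k2] S0 S1].
have [i iS i0] := not_without S0; have [j jS j1] := not_without S1.
have mcS : misses_from 3 (inord 2 |: S).
  case/misses_fromP: mS => l l3 lS; apply/misses_fromP; exists l => //.
  rewrite !inE negb_or lS andbT; apply/eqP => /(congr1 (@nat_of_ord _)).
  by rewrite v2; ord_lia.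
have inD (l : 'I_N.+1) : l \in S -> l != 2 :> nat -> l \in S :\ inord 2.
  move=> lS l2; rewrite !inE lS andbT; apply: contra l2 => /eqP ->.
  by rewrite v2.
split; first by rewrite /middle_faces /= mcS orbT.
- apply/and3P; split.
  + by apply/negP => /belowP/(_ k (inD k kS _)); ord_lia.
  + apply/orP; left; apply/negP => /withoutP/(_ i (inD i iS _)).
    by rewrite i0; ord_lia.
  + apply/orP; left; apply/negP => /withoutP/(_ j (inD j jS _)).
    by rewrite j1; ord_lia.
- by exists i, k; split => //; rewrite v2 i0.
Qed.

(** The new faces are those on [0, 3, ..., n.+3], with or without [1]. *)
Lemma toggle_one : toggle_stable middle_faces final_faces (inord 1).
Proof.
have v1 : (inord 1 : 'I_N.+1) = 1 :> nat by rewrite inordK.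
have v2 : (inord 2 : 'I_N.+1) = 2 :> nat by rewrite inordK.
move=> S /orP[->//|wS] nA'.
have nm : ~~ misses_from 3 S.
  by apply: contra nA' => mS; rewrite /middle_faces /= mS orbT.
have S0 : ~~ without 0 S.
  apply: contra nA' => w0.
  rewrite /middle_faces /start_faces /cone_faces /= w0 /=.
  suff -> : misses_from 2 S by rewrite orbT.
  apply/misses_fromP; exists (inord 2); rewrite ?v2 //.
  by apply/negP => /(withoutP _ _ wS); rewrite v2.
have [i iS i0] := not_without S0.
have S3 (l : 'I_N.+1) : (3 <= l)%N -> l \in S.
  by move=> l3; apply: contraR nm => lS; apply/misses_fromP; exists l.
have maxS : (ord_max : 'I_N.+1) \in S by exact: S3.
have inD (l : 'I_N.+1) : l \in S -> l != 1 :> nat -> l \in S :\ inord 1.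
  move=> lS l1; rewrite !inE lS andbT; apply: contra l1 => /eqP ->.
  by rewrite v1.
split.
- apply/orP; right; apply/withoutP => l; rewrite !inE => /orP[/eqP ->|].
    by rewrite v1.
  exact: (withoutP _ _ wS).
- have nm3 : ~~ misses_from 3 (S :\ inord 1).
    apply/negP => /misses_fromP[l l3]; rewrite inD ?S3 //; ord_lia.
  rewrite /middle_faces /start_faces /cone_faces /base_faces /=.
  rewrite (negPf nm3) !(andbF, orbF) negb_or negb_and.
  apply/andP; split.
    by apply/negP => /belowP/(_ ord_max (inD _ maxS _)) => /(_ isT).
  apply/orP; left; apply/negP => /withoutP/(_ i (inD i iS _)).
  by rewrite i0 => /(_ isT).
- by exists i, ord_max; rewrite v1 i0.
Qed.

Definition drop1 : ordmap N n.+2 :=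
  @nat_ordmap N n.+2 (subn^~ 1) (fun i j ij => leq_sub2r 1 ij).
Definition drop2 : ordmap N n.+1 :=
  @nat_ordmap N n.+1 (subn^~ 2) (fun i j ij => leq_sub2r 2 ij).
Definition cap2 : ordmap N 2 := @nat_ordmap N 2 id (fun i j ij => ij).

Lemma drop1E i : drop1 i = i - 1 :> nat.
Proof. rewrite nat_ordmapE; have := ltn_ord i; ord_lia. Qed.
Lemma drop2E i : drop2 i = i - 2 :> nat.
Proof. rewrite nat_ordmapE; have := ltn_ord i; ord_lia. Qed.
Lemma cap2E i : cap2 i = minn i 2 :> nat.
Proof. by rewrite nat_ordmapE. Qed.

Lemma cone_faces_horn m (t : ordmap m N) : cone_faces (img t) ->
  horn_pred ord0 (img (ord_comp drop1 t)).
Proof.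
case/andP => /withoutP w0 /misses_fromP[j j2 /notin_img jt].
apply/existsP; exists (drop1 j); apply/andP; split.
  by rewrite -(inj_eq (@ord_inj _)) drop1E /=; ord_lia.
apply/notin_img => i; have := w0 _ (mem_img t i); have := jt i.
rewrite -!(inj_eq (@ord_inj _)) ord_compE !drop1E; ord_lia.
Qed.

Lemma misses_bd m (t : ordmap m N) : misses_from 3 (img t) ->
  bd_pred (img (ord_comp drop2 t)).
Proof.
case/misses_fromP => [j j3 /notin_img jt].
apply/existsP; exists (drop2 j).
apply/notin_img => i; have := jt i.
rewrite -!(inj_eq (@ord_inj _)) ord_compE !drop2E; ord_lia.
Qed.

(** [F] is the given map on the boundary, [Q] a cone over it and [s] a triangle
    on a section of the leg of [Q] at the vertex [0]. *)
Variables (F : partial_map C n.+1) (Q : partial_map C n.+2) (s : C 2) (x : C 0).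
Hypothesis hC : quasicategory C.
Hypothesis nF : natural_on (@bd_pred n.+1) F.
Hypothesis Fx : F (ord_const 0 ord0) = x.
Hypothesis nQ : natural_on (@horn_pred n.+2 ord0) Q.
Hypothesis QF : forall m (t : ordmap m n.+1), bd_pred (img t) ->
  Q (ord_comp (coface ord0) t) = F t.

Definition edge01 : ordmap 1 n.+2 := @nat_ordmap 1 n.+2 id (fun i j ij => ij).
Lemma edge01E i : edge01 i = i :> nat.
Proof. rewrite nat_ordmapE; have := ltn_ord i; ord_lia. Qed.

Hypothesis s0 : dface 0 s = Q edge01.
Hypothesis s1 : dface 1 s = degen0 x.

Definition triangle_part : partial_map C N := fun m t => act (ord_comp cap2 t) s.
Definition cone_part : partial_map C N := fun m t => Q (ord_comp drop1 t).
Definition base_part : partial_map C N := fun m t => F (ord_comp drop2 t).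

Lemma triangle_part_natural : natural_on triangle_faces triangle_part.
Proof. by move=> l m f t _; rewrite /triangle_part ord_compA act_comp. Qed.

Lemma cone_part_natural : natural_on cone_faces cone_part.
Proof.
move=> l m f t At; rewrite /cone_part ord_compA nQ //.
exact: cone_faces_horn.
Qed.

Lemma base_part_natural : natural_on base_faces base_part.
Proof.
move=> l m f t /andP[_ At]; rewrite /base_part ord_compA nF //.
exact: misses_bd.
Qed.

Lemma cone_base_agree :
  agree_on (predI cone_faces base_faces) cone_part base_part.
Proof.
move=> m t /andP[/andP[/withoutP w0 _] /andP[/withoutP w1 m3]].
rewrite /cone_part /base_part -QF ?misses_bd //; congr Q; apply: ordmap_eq => i.
have := w0 _ (mem_img t i); have := w1 _ (mem_img t i).
rewrite !ord_compE drop1E /= /bump leq0n drop2E; ord_lia.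
Qed.

Lemma triangle_cone_agree :
  agree_on (predI triangle_faces cone_faces) triangle_part cone_part.
Proof.
move=> m t /andP[/belowP t2 /andP[/withoutP t0 _]].
rewrite /triangle_part /cone_part.
pose u : ordmap m 1 :=
  ord_comp (@nat_ordmap N 1 (subn^~ 1) (fun i j ij => leq_sub2r 1 ij)) t.
have uE i : u i = t i - 1 :> nat.
  by have := t2 _ (mem_img t i); rewrite ord_compE nat_ordmapE; ord_lia.
have -> : ord_comp cap2 t = ord_comp (coface (inord 0)) u.
  apply: ordmap_eq => i; have := t0 _ (mem_img t i); have := t2 _ (mem_img t i).
  by rewrite !ord_compE cap2E cofaceE // uE /bump; ord_lia.
have -> : ord_comp drop1 t = ord_comp edge01 u.
  by apply: ordmap_eq => i; rewrite !ord_compE drop1E edge01E uE.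
rewrite act_comp -/(dface 0 s) s0 nQ //.
apply/existsP; exists ord_max; rewrite -(inj_eq (@ord_inj _)) /=.
apply/notin_img => i; rewrite -(inj_eq (@ord_inj _)) edge01E /=.
by have := ltn_ord i; ord_lia.
Qed.

Lemma triangle_base_agree :
  agree_on (predI triangle_faces base_faces) triangle_part base_part.
Proof.
move=> m t /andP[/belowP t2 /andP[/withoutP t1 _]].
rewrite /triangle_part /base_part.
pose u : ordmap m 1 :=
  ord_comp (@nat_ordmap N 1 (subn^~ 1) (fun i j ij => leq_sub2r 1 ij)) t.
have uE i : u i = t i - 1 :> nat.
  by have := t2 _ (mem_img t i); rewrite ord_compE nat_ordmapE /=; ord_lia.
have -> : ord_comp cap2 t = ord_comp (coface (inord 1)) u.
  apply: ordmap_eq => i; have := t1 _ (mem_img t i); have := t2 _ (mem_img t i).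
  by rewrite !ord_compE cap2E cofaceE // uE /bump; ord_lia.
have -> : ord_comp drop2 t = ord_comp (ord_const 0 ord0) (ord_const m ord0).
  apply: ordmap_eq => i; have := t2 _ (mem_img t i).
  by rewrite !ord_compE drop2E /=; ord_lia.
rewrite act_comp -/(dface 1 s) s1 /degen0 -act_comp nF ?Fx.
  by apply: act_eq => i; rewrite !ord1.
by apply/existsP; exists ord_max; apply/notin_img.
Qed.

Lemma boundary_filler :
  exists z : C n.+1, agree_on (@bd_pred n.+1) F (fun m t => act t z).
Proof.
have ncb := glue_natural down_cone down_base cone_part_natural
  base_part_natural cone_base_agree.
have a1 : agree_on (predI triangle_faces (predU cone_faces base_faces))
    triangle_part (glue cone_faces cone_part base_part).
  move=> m t /andP[t1 /orP t23]; have [t2|t2] := boolP (cone_faces (img t)).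
    by rewrite glue_agreel // triangle_cone_agree //; apply/andP.
  have t3 : base_faces (img t) by case: t23 => // t2'; rewrite t2' in t2.
  rewrite (glue_agreer cone_base_agree) // triangle_base_agree //.
  exact/andP.
have nA := glue_natural down_triangle down_cone_base triangle_part_natural
  ncb a1.
have [G' nG' G'G] := extend_toggle hC down_start down_middle
  (fun S AS => introT orP (or_introl AS)) toggle_two nA.
have [G'' nG'' G''G'] := extend_toggle hC down_middle down_final
  (fun S AS => introT orP (or_introl AS)) toggle_one nG'.
have GE m (t : ordmap m N) : start_faces (img t) -> G'' m t =
    glue triangle_faces triangle_part (glue cone_faces cone_part base_part) t.
  by move=> At; rewrite G''G' ?G'G //; apply/orP; left.
(* [d] is the face of [Delta n.+3] on [0, 3, ..., n.+3]. *)
have d_mono (i j : nat) : (i <= j)%N ->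
    ((if i == 0 then 0 else i + 2) <= (if j == 0 then 0 else j + 2))%N.
  by case: eqP; case: eqP; ord_lia.
pose d := @nat_ordmap n.+1 N _ d_mono.
have dE i : d i = (if i == 0 :> nat then 0 else i + 2) :> nat.
  by rewrite nat_ordmapE; have := ltn_ord i; case: eqP; ord_lia.
have wd m (t : ordmap m n.+1) k :
    k \in [:: 1; 2] -> without k (img (ord_comp d t)).
  move=> k12; apply/withoutP => _ /imsetP[i _ ->]; rewrite ord_compE dE.
  by move: k12; rewrite !inE => /orP[] /eqP ->; case: ifP; ord_lia.
exists (G'' _ d) => m t bt.
rewrite -nG''; last first.
  by apply/orP; right; rewrite -(ord_comp_id d) wd.
case/existsP: (bt) => j /notin_img jt.
have [j0|j0] := eqVneq (j : nat) 0; last first.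
  have t3 : base_faces (img (ord_comp d t)).
    apply/andP; split; first exact: wd.
    apply/misses_fromP; exists (d j); first by rewrite dE (negPf j0); ord_lia.
    apply/notin_img => i; have := jt i.
    rewrite -!(inj_eq (@ord_inj _)) !ord_compE !dE (negPf j0).
    by case: ifP; ord_lia.
  rewrite GE; last by apply/orP; right; apply/orP; right.
  rewrite (glue_agreer a1); last by apply/orP; right.
  rewrite (glue_agreer cone_base_agree) // /base_part.
  congr F; apply: ordmap_eq => i.
  by rewrite !ord_compE drop2E dE; case: ifP; ord_lia.
have t0 i : t i != 0 :> nat.
  by have := jt i; rewrite -(inj_eq (@ord_inj _)) j0.
have t2 : cone_faces (img (ord_comp d t)).
  apply/andP; split.
    apply/withoutP => _ /imsetP[i _ ->]; rewrite ord_compE dE.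
    by rewrite (negPf (t0 i)); ord_lia.
  apply/misses_fromP; exists (inord 2); first by rewrite inordK.
  apply/negP => /(withoutP _ _ (wd _ t 2 isT)); rewrite inordK //.
rewrite GE; last by apply/orP; right; apply/orP; left.
rewrite (glue_agreer a1); last by apply/orP; left.
rewrite glue_agreel // /cone_part -QF //; congr Q; apply: ordmap_eq => i.
by rewrite !ord_compE drop1E dE (negPf (t0 i)) /= /bump leq0n; ord_lia.
Qed.
End Filler.

Lemma h_initial_fills (hC : quasicategory C) (hcone : has_boundary_cones)
    (x : C 0) :
  h_initial x -> fills_boundaries x.
Proof.
move=> xI n F nF Fx.
have [Q nQ QF] := hcone n F nF.
set e := @nat_ordmap 1 n.+2 id (fun i j ij => ij).
have be : horn_pred ord0 (img e).
  apply/existsP; exists ord_max; rewrite -(inj_eq (@ord_inj _)) /=.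
  apply/notin_img => i; rewrite -(inj_eq (@ord_inj _)) nat_ordmapE /=.
  by have := ltn_ord i; ord_lia.
have ex : dface 0 (Q 1 e) = x.
  rewrite /dface -nQ // -Fx -QF; last first.
    by apply/existsP; exists ord_max; apply/notin_img.
  congr Q; apply: ordmap_eq => i.
  by rewrite !ord_compE nat_ordmapE cofaceE // ord1.
have := @h_initial_section C hC (Q 1 e).
rewrite ex => /(_ xI)[f [s [s2 s0 s1]]].
exact: boundary_filler hC nF Fx nQ QF s0 s1.
Qed.

End BoundaryFilling.

(** * The boundary of a simplex is finite *)

(** A simplex of dimension greater than [n] takes the same value on two
    consecutive vertices, hence is degenerate. *)
Lemma nondegenerate_dim n m (t : boundary n m) :
  ~ @degenerate (boundary n) (existT _ m t) -> (m <= n)%N.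
Proof.
move=> nd; rewrite leqNgt; apply/negP => nm; apply: nd.
case: m => // m in t nm *.
have [i ti] : exists i : 'I_m.+1,
    sval t (inord i) = sval t (inord i.+1) :> nat.
  apply: contrapT => nti.
  have lt_t k : (k < m.+2)%N -> (k <= sval t (inord k))%N.
    elim: k => // k IH km; apply: leq_ltn_trans (IH (ltnW km)) _.
    rewrite ltn_neqAle ordmap_le ?inordK //; last exact: ltnW.
    rewrite andbT; apply/eqP => tk; apply: nti.
    by exists (Ordinal (n:=m.+1) (m:=k) km).
  have := leq_ltn_trans (lt_t m.+1 (leqnn _)) (ltn_ord _).
  by rewrite ltnS leqNgt nm.
exists m, i, (act (coface (inord i.+1)) t); congr existT.
apply: sval_inj; apply: ordmapP => k; apply: ord_inj.
have iS : (i.+1 < m.+2)%N by rewrite ltnS; apply: ltn_ord.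
change (sval t k = sval t (coface (inord i.+1) (codegen i k)) :> nat).
have [ki|ki] := eqVneq (k : nat) i.+1.
  have -> : k = inord i.+1 by apply: ord_inj; rewrite inordK.
  rewrite -ti; congr (nat_of_ord (sval t _)); apply: ord_inj.
  rewrite cofaceE; last exact: ltn_ord.
  rewrite codegenE !inordK // ?(ltnW iS) // /bump /unbump.
  by have := ltn_ord i; lia.
congr (nat_of_ord (sval t _)); apply: ord_inj.
rewrite cofaceE; last exact: ltn_ord.
by rewrite codegenE; move: ki; rewrite /bump /unbump; have := ltn_ord i; lia.
Qed.

Lemma finite_boundary n : finite_sset (boundary n).
Proof.
pose D := classical_sets.mkset (fun m => (m < n.+1)%N).
pose S m := classical_sets.image classical_sets.setT
  (fun t : boundary n m => existT (fun m => boundary n m) m t).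
apply: (@cardinality.sub_finite_set _ _ (classical_sets.bigcup D S)).
  by move=> [m t] /nondegenerate_dim mn; exists m => //; exists t.
apply: cardinality.bigcup_finite => [|m _]; first exact: cardinality.finite_II.
apply: cardinality.finite_image.
pose f (t : boundary n m) := [ffun i => sval t i].
apply: (@cardinality.finite_preimage _ _ classical_sets.setT f) => [t u _ _ tu|].
  apply: sval_inj; apply: ordmapP => i.
  by have /ffunP/(_ i) := tu; rewrite !ffunE.
exact: cardinality.finite_finset.
Qed.

(** * The join of a point and a simplex *)

Lemma Delta0_eq m (a b : Delta 0 m) : a = b.
Proof. by apply: ordmap_eq => i; rewrite !ord1. Qed.

Definition to_Delta0 (X : sSet) : sMap X (Delta 0) :=
  @SMap X (Delta 0) (fun m _ => ord_const m ord0) (fun _ _ _ _ => Delta0_eq _ _).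

(** The map [n.+1] -> [1] that separates the vertex [0] from the others, and the
    map [n.+1] -> [n] that lowers every other vertex by one. *)
Definition cut01 n : ordmap n.+1 1 := @nat_ordmap n.+1 1 id (fun i j ij => ij).

Lemma cut01E n (i : 'I_n.+2) : (cut01 n i == ord_max) = (0 < i)%N.
Proof. by rewrite -(inj_eq (@ord_inj _)) nat_ordmapE /=; lia. Qed.

Definition drop01 n : ordmap n.+1 n :=
  @nat_ordmap n.+1 n (subn^~ 1) (fun i j ij => leq_sub2r 1 ij).

Lemma drop01E n (i : 'I_n.+2) : drop01 n i = i - 1 :> nat.
Proof. by rewrite nat_ordmapE; have := ltn_ord i; ord_lia. Qed.

(** A vertex of the fibre of [p] over [e]. *)
Definition vtx n (p : ordmap n 1) e i (h : p i = e) : fiber p e 0 :=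
  exist (fiber_mem p e (m := 0)) (ord_const 0 i) (fun _ => h).

(** A simplex of [Delta 0 * Delta n] as a simplex of [Delta n.+1]: the cone
    point becomes the vertex [0] and the vertex [i] of [Delta n] becomes
    [i.+1]. *)
Section Flat.
Variables (n k : nat) (s : join_simplex (Delta 0) (Delta n) k).

Definition flat_fun (i : 'I_k.+1) : 'I_n.+2 :=
  match pselect (jcut s i = ord_max) with
  | left h => lift ord0 (jright s 0 (vtx h) ord0)
  | right _ => ord0
  end.

Lemma flat_fun0 i : jcut s i != ord_max -> flat_fun i = ord0.
Proof. by rewrite /flat_fun; case: pselect => // h /eqP[]. Qed.

Lemma flat_fun1 m (t : fiber (jcut s) ord_max m) i :
  flat_fun (sval t i) = (jright s m t i).+1 :> nat.
Proof.
rewrite /flat_fun; case: pselect => [h|[]]; last exact: (svalP t).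
rewrite lift0; congr (_.+1).
have -> : vtx h = act (ord_const 0 i) t by apply: sval_inj; apply: ordmap_eq.
by rewrite smap_act.
Qed.

Lemma flat_fun_pos i : (jcut s i == ord_max) = (0 < flat_fun i)%N.
Proof.
have [h|/flat_fun0 ->//] := eqVneq.
by rewrite -[i]/(sval (vtx h) ord0) flat_fun1.
Qed.

Lemma flat_subproof (i j : 'I_k.+1) : (i <= j)%N ->
  (flat_fun i <= flat_fun j)%N.
Proof.
move=> ij; have [hi|/flat_fun0 ->//] := eqVneq (jcut s i) ord_max.
have hj : jcut s j = ord_max.
  apply: ord_inj; apply/eqP; rewrite eqn_leq -ltnS ltn_ord /=.
  by have := ordmap_le (jcut s) ij; rewrite hi.
have eM (a b : 'I_2) : (a <= b)%N ->
    ((if a == ord0 then i else j) <= (if b == ord0 then i else j))%N.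
  case: (eqVneq b ord0) => [->|_]; last by case: ifP.
  by rewrite leqn0 => /eqP a0; have -> : a = ord0 by apply: ord_inj.
pose e := mk_ordmap eM.
have eF : fiber_mem (jcut s) ord_max e by move=> a /=; case: ifP.
have := flat_fun1 (exist _ e eF : fiber (jcut s) ord_max 1).
move=> H; have /= -> := H ord0; have /= -> := H ord_max.
by rewrite ltnS ordmap_le.
Qed.

Definition flat : ordmap k n.+1 := mk_ordmap flat_subproof.

Lemma flat0 i : jcut s i != ord_max -> flat i = 0 :> nat.
Proof. by move/flat_fun0 => /= ->. Qed.

Lemma flat1 m (t : fiber (jcut s) ord_max m) i :
  flat (sval t i) = (jright s m t i).+1 :> nat.
Proof. exact: flat_fun1. Qed.

Lemma flat_pos i : (jcut s i == ord_max) = (0 < flat i)%N.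
Proof. exact: flat_fun_pos. Qed.
End Flat.

Lemma flat_inj n k : injective (@flat n k).
Proof.
move=> a b ab; have ab' i : flat a i = flat b i by rewrite ab.
have cc i : jcut a i = jcut b i.
  have := flat_pos a i; rewrite ab' -flat_pos.
  case: (jcut a i) (jcut b i) => [[|[|?]] ?] [[|[|?]] ?] //=;
    rewrite -!(inj_eq (@ord_inj _)) //= => _; exact: ord_inj.
apply: join_simplexP => // m t ha hb; first exact: Delta0_eq.
apply: ordmap_eq => i; apply: succn_inj.
have := flat1 (exist _ t ha : fiber (jcut a) ord_max m) i.
have := flat1 (exist _ t hb : fiber (jcut b) ord_max m) i.
by rewrite [sval _]/= [sval _]/= ab' => -> ->.
Qed.

Lemma flat_eq n k (s : join_simplex (Delta 0) (Delta n) k) (t : ordmap k n.+1) :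
  (forall i, (jcut s i == ord_max) = (0 < t i)%N) ->
  (forall i (h : jcut s i = ord_max), (jright s 0 (vtx h) ord0).+1 = t i :> nat) ->
  flat s = t.
Proof.
move=> st0 st1; apply: ordmap_eq => i.
have [h|h] := eqVneq (jcut s i) ord_max.
  by rewrite -(st1 i h) -flat1.
by rewrite flat0 //; move: h; rewrite st0; case: (nat_of_ord (t i)).
Qed.

(** The inverse of [flat]. *)
Section Inflate.
Variables (n k : nat) (t : ordmap k n.+1).
Let p := ord_comp (cut01 n) t.

Lemma infl_subproof l m (f : ordmap l m) (s : fiber p ord_max m) :
  ord_comp (ord_comp (drop01 n) t) (sval (act f s)) =
  act f (ord_comp (ord_comp (drop01 n) t) (sval s) : Delta n m).
Proof. exact: ordmapP. Qed.

Definition infl : join_simplex (Delta 0) (Delta n) k :=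
  @JoinSimplex (Delta 0) (Delta n) k p (to_Delta0 _)
    (@SMap (fiber p ord_max) (Delta n) _ infl_subproof).
End Inflate.

Lemma inflK n k (t : ordmap k n.+1) : flat (infl t) = t.
Proof.
apply: flat_eq => [i|i h]; first by rewrite /= cut01E.
have ti : (0 < t i)%N by rewrite -cut01E; apply/eqP.
change ((drop01 n (t i)).+1 = t i :> nat); rewrite drop01E; ord_lia.
Qed.

Lemma flatK n k (s : join_simplex (Delta 0) (Delta n) k) : infl (flat s) = s.
Proof. by apply: flat_inj; rewrite inflK. Qed.

Lemma flat_act n l k (f : ordmap l k) (s : join (Delta 0) (Delta n) k) :
  flat (act f s) = ord_comp (flat s) f.
Proof.
apply: flat_eq => [i|i h]; first by rewrite ord_compE -flat_pos.
rewrite ord_compE.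
have h' : jcut s (f i) = ord_max by [].
rewrite -[f i]/(sval (vtx h') ord0) flat1; congr (_.+1).
by congr (nat_of_ord (jright s 0 _ ord0)); apply: sval_inj; apply: ordmap_eq.
Qed.

Lemma flat_inr n k (t : Delta n k) :
  flat (join_inr (Delta 0) (Delta n) k t) = ord_comp (coface ord0) t.
Proof. by apply: flat_eq => i; rewrite ord_compE /= ?/bump. Qed.

Lemma flat_inl n k (t : Delta 0 k) :
  flat (join_inl (Delta 0) (Delta n) k t) = ord_const k ord0.
Proof. by apply: flat_eq. Qed.

(** The map of joins induced by a monotone map on the second factor. *)
Definition dmap m n (t : ordmap m n) :
  sMap (join (Delta 0) (Delta m)) (join (Delta 0) (Delta n)) :=
  join_map (smap_id (Delta 0)) (Delta_map t).

Lemma flat_dmap n m k (t : ordmap m n) (s : join (Delta 0) (Delta m) k) i :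
  flat (dmap t k s) i =
    (if flat s i == 0 :> nat then 0 else (t (inord (flat s i - 1))).+1) :> nat.
Proof.
have [h|h] := eqVneq (jcut s i) ord_max; last first.
  by rewrite flat0 // flat0.
rewrite -[X in flat (dmap _ _ _) X]/(sval
  (vtx (h : jcut (dmap t k s) i = ord_max)) ord0).
rewrite flat1; have := flat_pos s i; rewrite h eqxx => /esym fi.
rewrite -if_neg -lt0n fi; congr (_.+1).
change (t (jright s 0 (vtx h) ord0) = t (inord (flat s i - 1)) :> nat).
congr (nat_of_ord (t _)).
by rewrite -[i in RHS]/(sval (vtx h) ord0) flat1 subn1 inord_val.
Qed.

(** For a simplex [t] of [Delta n.+1] that is not constant at [0], the simplex
    [pad t] of [Delta n] has the same dimension; it is [t] with its initial
    vertices [0] replaced by its first nonzero vertex, lowered by one.  It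
    allows the description of a simplex of [Delta 0 * Delta n] as the image of
    one of [Delta 0 * Delta k] under a map of the second factor, without
    splitting [k] into the dimensions of the two parts. *)
Section Pad.
Variables (n k : nat) (t : ordmap k n.+1).

(** The first vertex at which [t] is nonzero; the value is irrelevant when
    there is none. *)
Definition fst_pos : 'I_k.+1 := [arg min_(i < ord_max | (0 < t i)%N) (i : nat)].

Lemma pad_subproof (i j : 'I_k.+1) : (i <= j)%N ->
  (drop01 n (t (inord (maxn i fst_pos)))
    <= drop01 n (t (inord (maxn j fst_pos))))%N.
Proof.
move=> ij; apply/ordmap_le/ordmap_le; rewrite !inordK; try ord_lia.
  by have := ltn_ord j; have := ltn_ord fst_pos; ord_lia.
by have := ltn_ord i; have := ltn_ord fst_pos; ord_lia.
Qed.

Definition pad : ordmap k n := mk_ordmap pad_subproof.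

Lemma padE i : pad i = t (inord (maxn i fst_pos)) - 1 :> nat.
Proof. exact: drop01E. Qed.

Hypothesis t_pos : (0 < t ord_max)%N.

Lemma fst_posP : (0 < t fst_pos)%N.
Proof. by rewrite /fst_pos; case: arg_minnP. Qed.

Lemma fst_pos_le i : (0 < t i)%N = (fst_pos <= i)%N.
Proof.
apply/idP/idP => [|fi]; last exact: leq_trans fst_posP (ordmap_le t fi).
by rewrite /fst_pos; case: arg_minnP => // j _; apply.
Qed.

Lemma pad_pos i : (0 < t i)%N -> pad i = t i - 1 :> nat.
Proof.
by rewrite fst_pos_le padE => fi; rewrite (maxn_idPl fi) inord_val.
Qed.

Lemma pad_misses j : (forall i, t i != j.+1 :> nat) -> forall i, pad i != j :> nat.
Proof.
move=> tj i; rewrite padE.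
have fi : (fst_pos <= (inord (maxn i fst_pos) : 'I_k.+1))%N.
  rewrite inordK; first by ord_lia.
  by have := ltn_ord i; have := ltn_ord fst_pos; ord_lia.
by move: fi; rewrite -fst_pos_le; have := tj (inord (maxn i fst_pos)); ord_lia.
Qed.
End Pad.

Arguments flat : simpl never.
Arguments pad : simpl never.

(** * Initial objects are those that fill boundaries *)

(** The tautological simplex of [Delta 0 * Delta k] that is cut where [t] is: the
    vertices on which [t] is [0] go to the cone point, the others to
    themselves. *)
Section Std.
Variables (n k : nat) (t : ordmap k n.+1).

Lemma std_subproof (i j : 'I_k.+1) : (i <= j)%N ->
  ((if t i == ord0 then ord0 else lift ord0 i : 'I_k.+2) <=
   (if t j == ord0 then ord0 else lift ord0 j : 'I_k.+2))%N.
Proof.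
move=> ij; case: (eqVneq (t i)) => // ti; case: (eqVneq (t j)) => [tj|//].
by have := ordmap_le t ij; rewrite tj leqn0 => /eqP ti0;
  rewrite -(inj_eq (@ord_inj _)) ti0 in ti.
Qed.

Definition std : join (Delta 0) (Delta k) k := infl (mk_ordmap std_subproof).

Lemma flat_std i : flat std i = (if t i == 0 :> nat then 0 else i.+1) :> nat.
Proof.
rewrite inflK mk_ordmapE; have -> : (t i == ord0) = (t i == 0 :> nat) by [].
by case: ifP => // _; rewrite lift0.
Qed.
End Std.

(** This and [pad_act] express every simplex of [Delta 0 * Delta n] through a
    tautological one, naturally in the simplex. *)
Lemma dmap_pad_std n k (t : ordmap k n.+1) : (0 < t ord_max)%N ->
  dmap (pad t) k (std t) = infl t.
Proof.
move=> t_pos; apply: flat_inj; apply: ordmap_eq => i.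
rewrite inflK flat_dmap flat_std.
have [/eqP->//|ti] := boolP (t i == 0 :> nat).
transitivity (pad t (inord (i.+1 - 1))).+1 => //.
by rewrite subSS subn0 inord_val pad_pos ?subn1 ?prednK ?lt0n // -lt0n.
Qed.

Lemma dmap_comp l m n (t : ordmap m n) (f : ordmap l m) k
    (s : join (Delta 0) (Delta l) k) :
  dmap t k (dmap f k s) = dmap (ord_comp t f) k s.
Proof.
apply: join_simplexP => // r a ha hb; first exact: Delta0_eq.
by rewrite (Prop_irrelevance ha hb); apply: ordmap_eq.
Qed.

Lemma dmap_inl m n (t : ordmap m n) k (c : Delta 0 k) :
  dmap t k (join_inl (Delta 0) (Delta m) k c) = join_inl (Delta 0) (Delta n) k c.
Proof. by apply: flat_inj; apply: ordmap_eq => i; rewrite flat_dmap !flat_inl. Qed.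

Lemma dmap_inr m n (t : ordmap m n) k (c : Delta m k) :
  dmap t k (join_inr (Delta 0) (Delta m) k c) =
  join_inr (Delta 0) (Delta n) k (ord_comp t c).
Proof.
apply: flat_inj; apply: ordmap_eq => i; rewrite flat_dmap !flat_inr.
by rewrite !ord_compE !lift0 /= subn1 inord_val.
Qed.

Lemma pad_act n k l (t : ordmap k n.+1) (f : ordmap l k) :
  (0 < ord_comp t f ord_max)%N ->
  exists2 h : ordmap l k, pad (ord_comp t f) = ord_comp (pad t) h &
    dmap h l (std (ord_comp t f)) = act f (std t).
Proof.
move=> tf_pos; pose tf := ord_comp t f.
have t_pos : (0 < t ord_max)%N.
  by apply: leq_trans tf_pos _; rewrite ord_compE ordmap_le // leq_ord.
have gv (i : 'I_l.+1) :
    (inord (maxn i (fst_pos tf)) : 'I_l.+1) = maxn i (fst_pos tf) :> nat.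
  by rewrite inordK //; have := ltn_ord i; have := ltn_ord (fst_pos tf); ord_lia.
have gM (i j : 'I_l.+1) : (i <= j)%N ->
    ((inord (maxn i (fst_pos tf)) : 'I_l.+1) <=
     (inord (maxn j (fst_pos tf)) : 'I_l.+1))%N.
  by rewrite !gv; ord_lia.
exists (ord_comp f (mk_ordmap gM)).
  apply: ordmap_eq => i; rewrite padE !ord_compE mk_ordmapE pad_pos //.
  rewrite -[t (f _)]/(tf _) fst_pos_le // gv; ord_lia.
apply: flat_inj; apply: ordmap_eq => i.
rewrite flat_act flat_dmap ord_compE !flat_std.
have [//|tfi] := eqVneq (ord_comp t f i : nat) 0.
transitivity (f (mk_ordmap gM (inord (i.+1 - 1)))).+1 => //.
rewrite subSS subn0 inord_val.
congr (nat_of_ord (f _)).+1; apply: ord_inj; rewrite mk_ordmapE gv.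
by apply/maxn_idPl; rewrite -fst_pos_le // lt0n.
Qed.

Lemma dmap_pos n m k (t : ordmap m n) (s : join (Delta 0) (Delta m) k) i :
  (0 < flat (dmap t k s) i)%N = (0 < flat s i)%N.
Proof. by rewrite flat_dmap; case: (nat_of_ord (flat s i)). Qed.

Lemma fst_pos_eq n n' k (t : ordmap k n.+1) (t' : ordmap k n'.+1) :
  (0 < t ord_max)%N -> (forall i, (0 < t i)%N = (0 < t' i)%N) ->
  fst_pos t = fst_pos t'.
Proof.
move=> tp tt; have tp' : (0 < t' ord_max)%N by rewrite -tt.
apply: ord_inj; apply/eqP.
by rewrite eqn_leq -!fst_pos_le // tt -[X in _ && X]tt !fst_posP.
Qed.

Lemma pad_dmap n m k (t : ordmap m n) (s : join (Delta 0) (Delta m) k) :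
  (0 < flat s ord_max)%N ->
  pad (flat (dmap t k s)) = ord_comp t (pad (flat s)).
Proof.
move=> sp; apply: ordmap_eq => i.
have -> : pad (flat (dmap t k s)) i =
    flat (dmap t k s) (inord (maxn i (fst_pos (flat s)))) - 1 :> nat.
  rewrite padE (@fst_pos_eq _ _ _ _ (flat s)) // ?dmap_pos // => j.
  by rewrite dmap_pos.
have ip : (0 < flat s (inord (maxn i (fst_pos (flat s)))))%N.
  rewrite fst_pos_le // inordK; first by ord_lia.
  by have := ltn_ord i; have := ltn_ord (fst_pos (flat s)); ord_lia.
by rewrite flat_dmap -if_neg -lt0n ip -padE inord_val subn1.
Qed.

Lemma std_eq n n' k (t : ordmap k n.+1) (t' : ordmap k n'.+1) :
  (forall i, (0 < t i)%N = (0 < t' i)%N) -> std t = std t'.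
Proof.
move=> tt; apply: flat_inj; apply: ordmap_eq => i; rewrite !flat_std.
by rewrite -[RHS]if_neg -[LHS]if_neg -!lt0n tt.
Qed.

Lemma ordmap_max0 n k (t : ordmap k n.+1) : t ord_max = 0 :> nat ->
  t = ord_const k ord0.
Proof.
move=> t0; apply: ordmap_eq => i; apply/eqP; rewrite /= -leqn0 -t0.
by apply: ordmap_le; rewrite leq_ord.
Qed.

Lemma flat_max0 n k (s : join (Delta 0) (Delta n) k) : flat s ord_max = 0 :> nat ->
  s = join_inl (Delta 0) (Delta n) k (ord_const k ord0).
Proof. by move=> /ordmap_max0 s0; apply: flat_inj; rewrite s0 flat_inl. Qed.

Lemma coface0_drop n k (t : ordmap k n.+1) : (forall i, t i != 0 :> nat) ->
  ord_comp (coface ord0) (ord_comp (drop01 n) t) = t.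
Proof.
move=> t0; apply: ordmap_eq => i; rewrite !ord_compE /= /bump leq0n.
by rewrite drop01E; have := t0 i; ord_lia.
Qed.

Lemma bd_dmap n m k (t : ordmap m n) (s : join (Delta 0) (Delta m) k) :
  boundary_mem t -> bd_pred (img (flat (dmap t k s))).
Proof.
case=> j jt; apply/existsP; exists (lift ord0 j); apply/notin_img => i.
rewrite -(inj_eq (@ord_inj _)) flat_dmap lift0; case: ifP => // _.
by rewrite eqSS (inj_eq (@ord_inj _)).
Qed.

Lemma bd_const n k (i : 'I_n.+2) : bd_pred (img (ord_const k i)).
Proof.
apply/existsP; exists (if i == ord0 then ord_max else ord0).
by apply/notin_img => j; case: (eqVneq i ord0) => [->|].
Qed.

Lemma bd_coface0 n k (t : ordmap k n) : bd_pred (img (ord_comp (coface ord0) t)).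
Proof.
by apply/existsP; exists ord0; apply/notin_img => j; rewrite eq_sym neq_lift.
Qed.

Section Initial.
Variables (C : sSet) (x : C 0).

Lemma under_inl n (S : under (yo x) n) k (c : Delta 0 k) :
  sval S k (join_inl (Delta 0) (Delta n) k c) = act c x.
Proof.
have := svalP S => H; have := congr1 (fun f : sMap _ _ => f k c) H; exact.
Qed.

Section InitialFills.
Variables (n : nat) (F : partial_map C n.+1).
Hypothesis nF : natural_on (@bd_pred n.+1) F.
Hypothesis Fx : F (ord_const 0 ord0) = x.

Lemma F_const k : F (ord_const k ord0) = act (ord_const k ord0) x.
Proof.
have -> : ord_const k (ord0 : 'I_n.+2) =
    ord_comp (ord_const 0 ord0) (ord_const k ord0).
  exact: ordmap_eq.
by rewrite nF ?Fx //; apply: bd_const.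
Qed.

Lemma bmap_nat m (t : boundary n m) l k (f : ordmap l k)
    (s : join (Delta 0) (Delta m) k) :
  F (flat (dmap (sval t) l (act f s))) = act f (F (flat (dmap (sval t) k s))).
Proof. by rewrite smap_act flat_act nF //; apply/bd_dmap/(svalP t). Qed.

(** The map to [C_{x/}] from the boundary of [Delta n] that corresponds to a
    map [F] from the boundary of [Delta n.+1]. *)
Definition bmap m (t : boundary n m) : sMap (join (Delta 0) (Delta m)) C :=
  SMap (bmap_nat t).

Lemma bmap_under m (t : boundary n m) :
  smap_comp (bmap t) (join_inl (Delta 0) (Delta m)) = yo x.
Proof.
apply: sMapP => k c.
change (F (flat (dmap (sval t) k (join_inl (Delta 0) (Delta m) k c))) = act c x).
by rewrite dmap_inl flat_inl F_const; congr act; apply: Delta0_eq.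
Qed.

Definition bunder m (t : boundary n m) : under (yo x) m :=
  exist _ (bmap t) (bmap_under t).

Lemma bunder_nat l m (f : ordmap l m) (t : boundary n m) :
  bunder (act f t) = act f (bunder t).
Proof.
apply: sval_inj; apply: sMapP => k s.
change (F (flat (dmap (ord_comp (sval t) f) k s)) =
        F (flat (dmap (sval t) k (dmap f k s)))).
by rewrite dmap_comp.
Qed.

Lemma base_nat l m (f : ordmap l m) (t : Delta n m) :
  F (ord_comp (coface ord0) (act f t)) = act f (F (ord_comp (coface ord0) t)).
Proof. by rewrite -nF ?ord_compA //; apply: bd_coface0. Qed.

Lemma initial_filler : initial x ->
  exists z : C n.+1, agree_on (@bd_pred n.+1) F (fun m t => act t z).
Proof.
move=> /(_ n (SMap bunder_nat) (SMap base_nat))[|w [wu wv]].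
  apply: sMapP => k t.
  change (F (flat (dmap (sval t) k (join_inr (Delta 0) (Delta k) k (ord_id k))))
          = F (ord_comp (coface ord0) (sval t))).
  by rewrite dmap_inr flat_inr ord_comp_id.
pose W : under (yo x) n := w n (ord_id n).
have wE k (t : Delta n k) : w k t = act t W.
  by rewrite /W -smap_act; congr smap; apply: ordmap_eq.
exists (sval W n.+1 (infl (ord_id n.+1))) => m t bt.
have -> : act t (sval W n.+1 (infl (ord_id n.+1))) = sval W m (infl t).
  rewrite -smap_act; congr (smap (sval W)); apply: flat_inj.
  by rewrite flat_act !inflK ord_id_comp.
have [t0|tp] := posnP (t ord_max).
  rewrite (@flat_max0 _ _ (infl t)) ?inflK // under_inl (ordmap_max0 t0).
  exact: F_const.
have [j /notin_img jt] := existsP bt.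
have [j0|j0] := eqVneq (j : nat) 0.
  have t0 i : t i != 0 :> nat by have := jt i; rewrite -(inj_eq (@ord_inj _)) j0.
  rewrite -(coface0_drop t0); set t' := ord_comp (drop01 n) t.
  have -> : infl (ord_comp (coface ord0) t') = join_inr (Delta 0) (Delta n) m t'.
    by apply: flat_inj; rewrite inflK flat_inr.
  transitivity (smap_comp (under_proj (yo x)) w m t'); first by rewrite wv.
  rewrite /= wE.
  change (sval W m (dmap t' m (join_inr (Delta 0) (Delta m) m (ord_id m))) =
          sval W m (join_inr (Delta 0) (Delta n) m t')).
  by rewrite dmap_inr ord_comp_id.
have pt : boundary_mem (pad t).
  exists (drop01 n j) => i; rewrite -(inj_eq (@ord_inj _)).
  apply: pad_misses => // l; rewrite drop01E.
  by have := jt l; rewrite -(inj_eq (@ord_inj _)); ord_lia.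
rewrite -[in RHS](dmap_pad_std tp).
change (F t = sval (act (pad t : ordmap m n) W) m (std t)).
rewrite -wE.
transitivity (sval (smap_comp w (sub_incl (boundary n)) m
  (exist _ (pad t) pt)) m (std t)) => //.
rewrite wu.
change (F t = F (flat (dmap (pad t) m (std t)))).
by rewrite dmap_pad_std // inflK.
Qed.
End InitialFills.

Lemma initial_fills : initial x -> fills_boundaries x.
Proof. by move=> xI n F nF Fx; apply: initial_filler. Qed.

Section FillsInitial.
Variables (n : nat) (u : sMap (boundary n) (under (yo x))) (v : sMap (Delta n) C).
Hypothesis uv :
  smap_comp (under_proj (yo x)) u = smap_comp v (sub_incl (boundary n)).

(** The map on the boundary of [Delta n.+1] that corresponds to a lifting
    problem [u], [v] for [C_{x/} -> C]: it is [v] on the facet opposite to [0]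
    and is given by [u] on the others. *)
Definition bfun : partial_map C n.+1 := fun k t =>
  if t ord_max == 0 :> nat then act (ord_const k ord0) x else
  match pselect (boundary_mem (pad t)) with
  | left h => sval (u k (exist _ (pad t) h)) k (std t)
  | right _ => v k (pad t)
  end.

Lemma bfun0 k : bfun (ord_const k ord0) = act (ord_const k ord0) x.
Proof. by rewrite /bfun eqxx. Qed.

(** This description by [u] applies to any simplex [t] not constant at [0] for
    which [pad t] lies in the boundary. *)
Lemma bfun_u k (t : ordmap k n.+1) (p : boundary n k) : (0 < t ord_max)%N ->
  pad t = sval p -> bfun t = sval (u k p) k (std t).
Proof.
move=> tp tE; rewrite /bfun gtn_eqF //.
case: pselect => [h|[]]; last by rewrite tE; apply: (svalP p).
by have -> : exist _ (pad t) h = p by apply: sval_inj.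
Qed.

Lemma bfun_v k (t : ordmap k n) : bfun (ord_comp (coface ord0) t) = v k t.
Proof.
set t' := ord_comp _ t.
have t'0 i : (0 < t' i)%N by [].
have pE : pad t' = t.
  by apply: ordmap_eq => i; rewrite pad_pos // ord_compE /= /bump; ord_lia.
have [h|h] := pselect (boundary_mem t); last first.
  by rewrite /bfun gtn_eqF // pE; case: pselect.
rewrite (@bfun_u _ _ (exist _ t h)) //.
have -> : std t' = join_inr (Delta 0) (Delta k) k (ord_id k).
  apply: flat_inj; apply: ordmap_eq => i.
  by rewrite flat_std flat_inr gtn_eqF.
have /= := congr1 (fun f : sMap _ _ => f k (exist _ t h : boundary n k)) uv.
exact.
Qed.

Lemma bfun_natural : natural_on (@bd_pred n.+1) bfun.
Proof.
move=> l k f t bt.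
have [t0|tp] := posnP (t ord_max).
  rewrite (ordmap_max0 t0).
  have -> : ord_comp (ord_const k ord0) f = ord_const l (ord0 : 'I_n.+2).
    exact: ordmap_eq.
  by rewrite !bfun0 -act_comp; congr act; apply: ordmap_eq.
have [j /notin_img jt] := existsP bt.
have [j0|j0] := eqVneq (j : nat) 0.
  have t0 i : t i != 0 :> nat by have := jt i; rewrite -(inj_eq (@ord_inj _)) j0.
  by rewrite -(coface0_drop t0) -ord_compA !bfun_v -smap_act.
have pt : boundary_mem (pad t).
  exists (drop01 n j) => i; rewrite -(inj_eq (@ord_inj _)).
  apply: pad_misses => // r; rewrite drop01E.
  by have := jt r; rewrite -(inj_eq (@ord_inj _)); ord_lia.
pose p : boundary n k := exist _ (pad t) pt.
rewrite (@bfun_u _ t p) // -smap_act.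
have [tf0|tfp] := posnP (ord_comp t f ord_max).
  rewrite (ordmap_max0 tf0) bfun0 (@flat_max0 _ _ (act f (std t))) ?under_inl //.
  by rewrite flat_act ord_compE flat_std tf0.
have [h ph <-] := pad_act tfp.
rewrite (@bfun_u _ _ (act h p)) // smap_act.
by [].
Qed.

Lemma fills_lift : fills_boundaries x -> exists w : sMap (Delta n) (under (yo x)),
  smap_comp w (sub_incl (boundary n)) = u /\ smap_comp (under_proj (yo x)) w = v.
Proof.
move=> /(_ n bfun bfun_natural)[|z zE].
  by rewrite bfun0; apply: act_eq_id => i; rewrite !ord1.
have fn l k (f : ordmap l k) (s : join (Delta 0) (Delta n) k) :
    act (flat (act f s)) z = act f (act (flat s) z).
  by rewrite flat_act act_comp.
have fx : smap_comp (SMap fn : sMap (join (Delta 0) (Delta n)) C)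
    (join_inl (Delta 0) (Delta n)) = yo x.
  apply: sMapP => k c.
  change (act (flat (join_inl (Delta 0) (Delta n) k c)) z = act c x).
  rewrite flat_inl -zE; last exact: bd_const.
  by rewrite bfun0; congr act; apply: Delta0_eq.
pose W : under (yo x) n := exist _ _ fx.
exists (yo W); split; apply: sMapP => k.
  move=> p; apply: sval_inj; apply: sMapP => l s.
  change (act (flat (dmap (sval p) l s)) z = sval (u k p) l s).
  rewrite -zE; last exact/bd_dmap/(svalP p).
  have [s0|sp] := posnP (flat s ord_max).
    by rewrite (flat_max0 s0) dmap_inl flat_inl bfun0 under_inl.
  have tp : (0 < flat (dmap (sval p) l s) ord_max)%N by rewrite dmap_pos.
  rewrite (@bfun_u _ _ (act (pad (flat s)) p)) ?pad_dmap // smap_act.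
  rewrite (@std_eq _ _ _ _ (flat s)); last by move=> i; rewrite dmap_pos.
  change (sval (u k p) l (dmap (pad (flat s)) l (std (flat s))) = sval (u k p) l s).
  by rewrite dmap_pad_std // flatK.
move=> t.
change (act (flat (dmap t k (join_inr (Delta 0) (Delta k) k (ord_id k)))) z = v k t).
rewrite dmap_inr flat_inr ord_comp_id -zE ?bfun_v //; exact: bd_coface0.
Qed.
End FillsInitial.

Lemma fills_initial : fills_boundaries x -> initial x.
Proof. by move=> xF n u v uv; apply: fills_lift. Qed.

End Initial.

(** * Filling boundaries implies h-initial *)

Section FillsHInitial.
Variables (C : sSet) (x : C 0).
Hypothesis xF : fills_boundaries x.

Lemma fills_edge (y : C 0) : exists e : C 1, dface 1 e = x /\ dface 0 e = y.
Proof.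
pose F : partial_map C 1 := fun m t =>
  act (ord_const m ord0) (if t ord0 == ord0 then x else y).
have FE m (t : ordmap m 1) : F m t =
  act (ord_const m ord0) (if t ord0 == ord0 then x else y) by [].
have [l m f t /existsP[j /notin_img jt]||z zE] := xF (n := 0) (F := F).
- rewrite !FE -act_comp.
  have -> : ord_comp t f ord0 = t ord0.
    have two (a b c : 'I_2) : a != c -> b != c -> a = b.
      move=> ac bc; apply: ord_inj; move: ac bc; rewrite -!(inj_eq (@ord_inj _)).
      by have := ltn_ord a; have := ltn_ord b; have := ltn_ord c; lia.
    exact: two (jt _) (jt _).
  by apply: act_eq.
- by rewrite FE eqxx; apply: act_eq_id => i; rewrite !ord1.
have bd (i : 'I_2) : bd_pred (img (coface i)).
  by apply/existsP; exists i; apply/notin_img => j; rewrite eq_sym neq_lift.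
exists z; rewrite /dface -!zE // !FE; split.
  rewrite (_ : _ == _ = true); last by rewrite -(inj_eq (@ord_inj _)) cofaceE.
  by apply: act_eq_id => i; rewrite !ord1.
rewrite (_ : _ == _ = false); last by rewrite -(inj_eq (@ord_inj _)) cofaceE.
by apply: act_eq_id => i; rewrite !ord1.
Qed.

Lemma fills_triangle (e g h : C 1) : dface 1 e = x -> dface 1 h = x ->
  dface 0 e = dface 1 g -> dface 0 h = dface 0 g -> comp2 e g h.
Proof.
move=> ex hx eg hg.
have [|F nF FE] := @glue_faces C 0 predT
  (fun j => if j == 0 then g else if j == 1 then h else e).
  move=> [|[|[|i]]] [|[|[|j]]] //= ij _ _; try by case/andP: ij.
  by rewrite hx ex.
have bp (S : {set 'I_3}) : bd_pred S -> misses predT S by [].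
have [l m f t /bp|| z zE] := xF (n := 1) (F := F); first exact: nF.
  have -> : ord_const 0 ord0 =
      ord_comp (coface (inord 2)) (coface (inord 1) : ordmap 0 1).
    by apply: ordmap_eq => i; rewrite ord_compE !cofaceE // ord1.
  rewrite nF ?FE //.
  apply/existsP; exists (inord 2).
  by apply/notin_img => j; rewrite eq_sym neq_lift.
have bd (i : 'I_3) : bd_pred (img (coface i)).
  by apply/existsP; exists i; apply/notin_img => j; rewrite eq_sym neq_lift.
by exists z; split; rewrite /dface -zE // FE.
Qed.

(** By induction on [q]: by boundary filling, any three edges that bound a
    triangle with [x] as its vertex [0] compose. *)
Lemma fills_path y z (e : edge x y) (q : epath y z) (h : edge x z) :
  econg (econs e q) (epath1 h).
Proof.
have triE a b (f : edge x a) (g : edge a b) (k : edge x b) :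
    econg (epath1 k) (ecat (epath1 f) (epath1 g)).
  have [fx fa] := edge_ends f; have [ga gb] := edge_ends g.
  have [kx kb] := edge_ends k.
  have [|||| s [s2 s0 s1]] := @fills_triangle (sval f) (sval g) (sval k) => //.
  - by rewrite fa ga.
  - by rewrite kb gb.
  apply: (@econg_triangle _ _ _ _ _ _ _ s); rewrite dface_coface //.
pose d : edge x x := mk_edge (dface_degen0 1 x) (dface_degen0 0 x).
elim: q e h => [w|a b c f q IH] e h.
  apply: econg_trans (triE _ _ d h e) _.
  rewrite -[epath1 h]/(ecat (enil x) (epath1 h)).
  apply: econg_cat (econg_refl _).
  exact: econg_degen.
have [h0 [h0x h0b]] := fills_edge b.
pose k : edge x b := mk_edge h0x h0b.
apply: econg_trans (IH k h).
rewrite -[econs e _]/(ecat (ecat (epath1 e) (epath1 f)) q).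
rewrite -[econs k _]/(ecat (epath1 k) q).
apply: econg_cat (econg_refl _).
exact/econg_sym/triE.
Qed.

Lemma fills_h_initial : h_initial x.
Proof.
move=> y; have [e [ex ey]] := fills_edge y.
exists (ho_class (epath1 (mk_edge ex ey))); split=> // f _.
rewrite -(ho_reprK f); apply/ho_classP/econg_sym.
set p := ho_repr f.
pose d : edge x x := mk_edge (dface_degen0 1 x) (dface_degen0 0 x).
apply: econg_trans (fills_path d p _).
rewrite -[econs d p]/(ecat (epath1 d) p) -[X in econg X _]/(ecat (enil x) p).
apply: econg_cat (econg_refl _).
exact/econg_sym/econg_degen.
Qed.
End FillsHInitial.

(** * Cones over boundaries from finite limits *)

Section Cones.
Variables (C : sSet) (n : nat) (F : partial_map C n.+1).
Hypothesis nF : natural_on (@bd_pred n.+1) F.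

Lemma bd_diagram_nat m k (f : ordmap m k) (t : boundary n.+1 k) :
  F (sval (act f t)) = act f (F (sval t)).
Proof. by rewrite -nF //; apply/boundary_memE/(svalP t). Qed.

(** A partial map on the boundary of [Delta n.+1] as a map of simplicial sets. *)
Definition bd_diagram : sMap (boundary n.+1) C := SMap bd_diagram_nat.

Lemma cone_fiber_mem k (t : ordmap k n.+2) : horn_pred ord0 (img t) ->
  forall m (s : fiber (ord_comp (cut01 n.+1) t) ord_max m),
  boundary_mem (ord_comp (ord_comp (drop01 n.+1) t) (sval s)).
Proof.
move=> /existsP[j /andP[j0 /notin_img jt]] m [s sF].
exists (drop01 n.+1 j) => i.
rewrite -(inj_eq (@ord_inj _)) !ord_compE !drop01E.
have := sF i; move/eqP; rewrite ord_compE cut01E => tp.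
by have := jt (s i); move: j0; rewrite -!(inj_eq (@ord_inj _)) /=; ord_lia.
Qed.

Definition cone_right k (t : ordmap k n.+2) (h : horn_pred ord0 (img t)) m
    (s : fiber (ord_comp (cut01 n.+1) t) ord_max m) : boundary n.+1 m :=
  exist _ _ (cone_fiber_mem h s).

Lemma cone_right_nat k (t : ordmap k n.+2) (h : horn_pred ord0 (img t))
    l m (f : ordmap l m) (s : fiber (ord_comp (cut01 n.+1) t) ord_max m) :
  cone_right h (act f s) = act f (cone_right h s).
Proof. by apply: sval_inj; apply: ordmap_eq. Qed.

(** A simplex of the horn of [Delta n.+2] at [0] as a simplex of the join of a
    point and the boundary of [Delta n.+1]. *)
Definition cone_simplex k (t : ordmap k n.+2) (h : horn_pred ord0 (img t)) :
    join (Delta 0) (boundary n.+1) k :=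
  @JoinSimplex (Delta 0) (boundary n.+1) k (ord_comp (cut01 n.+1) t)
    (to_Delta0 _) (SMap (cone_right_nat h)).

Lemma cone_extension : has_limit bd_diagram ->
  exists2 Q : partial_map C n.+2, natural_on (@horn_pred n.+2 ord0) Q &
    forall m (t : ordmap m n.+1), bd_pred (img t) ->
      Q m (ord_comp (coface ord0) t) = F t.
Proof.
case=> -[L LF] _.
pose Q : partial_map C n.+2 := fun k t =>
  match pselect (horn_pred ord0 (img t)) with
  | left h => L k (cone_simplex h)
  | right _ => act (ord_const k ord0)
      (L 0 (join_inl (Delta 0) (boundary n.+1) 0 (ord_id 0)))
  end.
have QE k t (h : horn_pred ord0 (img t)) : Q k t = L k (cone_simplex h).
  rewrite /Q; case: pselect => // h'.
  by rewrite (Prop_irrelevance h h').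
exists Q => [l m f t h|m t bt].
  have h' : horn_pred ord0 (img (ord_comp t f)).
    case/existsP: h => j /andP[j0 jt]; apply/existsP; exists j; rewrite j0 /=.
    by apply: contra jt; apply: (subsetP (img_comp _ _)).
  rewrite !QE -smap_act; congr smap.
  apply: join_simplexP => // r a ha hb.
  by apply: sval_inj; apply: ordmap_eq.
have h : horn_pred ord0 (img (ord_comp (coface ord0) t)).
  case/existsP: bt => j /notin_img jt; apply/existsP; exists (lift ord0 j).
  apply/notin_img => i; rewrite ord_compE (inj_eq (@lift_inj _ _)); exact: jt.
have bt' : boundary_mem t by apply/boundary_memE.
transitivity (smap_comp L (join_inr (Delta 0) (boundary n.+1)) m (exist _ t bt')).
  rewrite QE /=; congr smap.
  apply: join_simplexP => [i|r a ha hb|r a ha hb].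
  - by apply/eqP; rewrite cut01E.
  - exact: Delta0_eq.
  apply: sval_inj; apply: ordmap_eq => i /=.
  change (drop01 n.+1 (lift ord0 (t (a i))) = t (a i) :> nat).
  by rewrite drop01E lift0 subn1.
by rewrite LF.
Qed.
End Cones.

Lemma finite_limits_cones (C : sSet) :
  admits_finite_limits C -> has_boundary_cones C.
Proof.
move=> lim n F nF.
exact: cone_extension (lim _ (finite_boundary _) (bd_diagram nF)).
Qed.

Theorem proposition2p2p2 (C : sSet) (hC : quasicategory C)
  (hlim : admits_finite_limits C) (x : C 0) :
  h_initial x <-> initial x.
Proof.
split=> [xI|xI]; last exact/fills_h_initial/initial_fills.
exact/fills_initial/(h_initial_fills hC (finite_limits_cones hlim)).
Qed.
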